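(* Let $n\ge1$ be an integer and let $w>-1$ be a real number, with $w<\frac{1}{n-1}$ if $n\ge2$. Then the simplex $\mathcal{Q}_n(w)$ can be dissected into an $n$-dimensional rectangular parallelepiped using at most $n!$ pieces; that is, there exist an integer $k$ with $1\le k\le n!$, positive reals $\ell_1,\dots,\ell_n$, polytopes $P_1,\dots,P_k,Q_1,\dots,Q_k\subset\mathbb{R}^n$ with $\mathcal{Q}_n(w)=P_1+\cdots+P_k$ and $I_{\ell_1}\times\cdots\times I_{\ell_n}=Q_1+\cdots+Q_k$, and isometries $g_1,\dots,g_k$ of $\mathbb{R}^n$ such that $g_i(P_i)=Q_i$ for $i=1,\dots,k$.
   Context: For $n\ge1$ and $w$ as in the claim, let $v_1,\dots,v_n$ be unit vectors in $\mathbb{R}^n$ with $v_i\cdot v_j=-w$ for $i\ne j$. Then $\mathcal{Q}_n(w)$ is the simplex $\{\sum_{i=1}^n\lambda_iv_i : 1\ge\lambda_1\ge\cdots\ge\lambda_n\ge0\}$; it is determined up to isometry by $n$ and $w$. $I_\ell$ denotes an interval of length $\ell$. A polytope in $\mathbb{R}^n$ is a union of finitely many bounded $n$-dimensional simplices (not necessarily convex or connected). For polytopes, $P=P_1+\cdots+P_k$ means that $P=P_1\cup\cdots\cup P_k$ and the interiors of $P_1,\dots,P_k$ are pairwise disjoint. Isometries may be orientation-reversing. *)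

(* Defs.v *)
From HB Require Import structures.
From mathcomp Require Export all_boot all_order all_algebra.
From mathcomp Require Export all_classical all_reals all_analysis.

Set Implicit Arguments.
Unset Strict Implicit.
Unset Printing Implicit Defensive.

Import Order.TTheory GRing.Theory Num.Theory.
Import numFieldNormedType.Exports.

Local Open Scope classical_set_scope.
Local Open Scope ring_scope.

(* The library norm `|u| on 'rV[R]_n is the sup norm, so the Euclidean
   structure is set up by hand.  The library topology on 'rV[R]_n (used through
   the interior A°) is the product topology, i.e. the Euclidean one. *)
Definition dot (R : realType) (n : nat) (u v : 'rV[R]_n) : R :=
  \sum_(i < n) u 0 i * v 0 i.

Definition edist (R : realType) (n : nat) (x y : 'rV[R]_n) : R :=
  Num.sqrt (dot (x - y) (x - y)).

(* Surjectivity is automatic for distance-preserving self-maps of R^n. *)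
Definition eisometry (R : realType) (n : nat) (g : 'rV[R]_n -> 'rV[R]_n) : Prop :=
  forall x y, edist (g x) (g y) = edist x y.

Definition affine_indep (R : realType) (n m : nat) (p : 'I_m -> 'rV[R]_n) : Prop :=
  forall c : 'I_m -> R,
    \sum_(i < m) c i = 0 -> \sum_(i < m) c i *: p i = 0 -> forall i, c i = 0.

Definition convex_hull (R : realType) (n m : nat) (p : 'I_m -> 'rV[R]_n) :
    set 'rV[R]_n :=
  [set x | exists c : 'I_m -> R,
    [/\ forall i, 0 <= c i, \sum_(i < m) c i = 1 & x = \sum_(i < m) c i *: p i]].

Definition nsimplex (R : realType) (n : nat) (A : set 'rV[R]_n) : Prop :=
  exists p : 'I_n.+1 -> 'rV[R]_n, affine_indep p /\ A = convex_hull p.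

(* The union is over at least one simplex: the empty set is not a polytope, so
   that empty pieces are not counted in a dissection. *)
Definition polytope (R : realType) (n : nat) (A : set 'rV[R]_n) : Prop :=
  exists (m : nat) (S : 'I_m.+1 -> set 'rV[R]_n),
    (forall j, nsimplex (S j)) /\ A = \bigcup_j S j.

(* A = P_0 + ... + P_(k-1) *)
Definition dissection (R : realType) (n k : nat) (A : set 'rV[R]_n)
    (P : 'I_k -> set 'rV[R]_n) : Prop :=
  A = \bigcup_i P i /\ trivIset setT (fun i => (P i)°).

(* With v_i of unit length and v_i . v_j = - w for i != j, this is Q_n(w). *)
Definition Qsimplex (R : realType) (n : nat) (v : 'I_n -> 'rV[R]_n) :
    set 'rV[R]_n :=
  [set x | exists lam : 'I_n -> R,
    [/\ forall i, 0 <= lam i <= 1,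
        forall i j : 'I_n, (i <= j)%N -> lam j <= lam i
      & x = \sum_(i < n) lam i *: v i]].

Definition box (R : realType) (n : nat) (l : 'I_n -> R) : set 'rV[R]_n :=
  [set x | forall i, 0 <= x 0 i <= l i].

(* Main.v *)
(** Write [x] for the coordinates of a point in the basis [v], with [x_n := 0],
    and let [h_j x := x_0 + ... + x_(j-1) - j x_j] (a Helmert basis), so that the
    squared length is the diagonal form [sum_j c_j h_j^2] with [c_j > 0].  Consider
      [A_m := { 0 <= h_j <= 1 for m < j <= n, x_0 >= ... >= x_m, x_0 - x_m <= 1 }].
    Then [A_n] is the simplex and [A_0] the brick.  The prism
    [x_0 >= ... >= x_k >= x_0 - 1] (with the same bounds on [h_j], [j > k + 1]) is
    invariant under the screw motion [tau] permuting [x_0, ..., x_k] cyclically and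
    raising [h_(k+1)] by one, and both [A_k] and [A_(k+1)] are fundamental domains
    of the group generated by [tau]; since [0 <= h_(k+1) <= k + 1] on [A_(k+1)], the
    powers [tau^0, ..., tau^k] match them piecewise.  Composing the [n] steps
    gives at most [n!] convex pieces, and those with empty interior can be dropped.
    A remaining piece is a polytope: cutting by half-spaces keeps it the convex
    hull of finitely many points, and Caratheodory's theorem does the rest. *)

Require Import Defs.
From mathcomp Require Import perm ring lra zify.

Import Order.TTheory GRing.Theory Num.Theory.
Import numFieldNormedType.Exports.

Set Implicit Arguments.
Unset Strict Implicit.
Unset Printing Implicit Defensive.

Local Open Scope classical_set_scope.
Local Open Scope ring_scope.

(** * Affine bijections and interiors *)

Section Affine.
Variables (R : realType) (n : nat).
Implicit Types (x y : 'rV[R]_n) (A B : set 'rV[R]_n).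

Definition affine_bij (g : 'rV[R]_n -> 'rV[R]_n) : Prop :=
  exists (M : 'M[R]_n) (t : 'rV[R]_n), M \in unitmx /\ g = fun x => x *m M + t.

Definition lin (f : 'rV[R]_n -> R) : Prop :=
  exists u : 'cV[R]_n, forall x, f x = (x *m u) 0 0.

(** A finite intersection of closed half-spaces, possibly unbounded or empty; that it is the hull of
    finitely many points is established separately, through [fingen]. *)
Definition hpoly A : Prop :=
  exists s : seq ('cV[R]_n * R),
    A = [set x | forall c, c \in s -> (x *m c.1) 0 0 <= c.2].

Lemma mulmx_continuous p (M : 'M[R]_(n, p)) :
  continuous (fun x : 'rV[R]_n => x *m M).
Proof.
move=> x A [P xP PA].
have Pi (i : 'I_1) (j : 'I_p) :
    \forall y \near x, P i j ((y *m M) i j).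
  have c : continuous (fun y : 'rV[R]_n => (y *m M) i j).
    rewrite (_ : (fun y : 'rV[R]_n => _) = fun y => \sum_k y i k * M k j).
      apply: continuous_big => [|k _]; first exact: add_continuous.
      by move=> z; exact: (cvgM (@coord_continuous R 1 n i k z) (cvg_cst (M k j))).
    by apply/funext => y; rewrite mxE.
  exact: c (xP i j).
have : \forall y \near x, forall ij : 'I_1 * 'I_p, P ij.1 ij.2 ((y *m M) ij.1 ij.2).
  exact: (@filter_forall _ ('I_1 * 'I_p)%type
    (fun ij y => P ij.1 ij.2 ((y *m M) ij.1 ij.2)) _ _ (fun ij => Pi ij.1 ij.2)).
by apply: filterS => y Py; apply: PA => i j; exact: (Py (i, j)).
Qed.

Lemma affine_bij_continuous g : affine_bij g -> continuous g.
Proof.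
move=> [M [t [_ ->]]] x.
exact: (cvgD (@mulmx_continuous n M x) (cvg_cst t)).
Qed.

Lemma affine_bij_id : affine_bij id.
Proof. by exists 1%:M, 0; split; [exact: unitmx1|apply/funext=> x; rewrite mulmx1 addr0]. Qed.

Lemma affine_bij_comp g h : affine_bij g -> affine_bij h -> affine_bij (g \o h).
Proof.
move=> [M [t [uM ->]]] [N [s [uN ->]]]; exists (N *m M), (s *m M + t).
by split; [rewrite unitmx_mul uN|apply/funext => x /=; rewrite mulmxDl mulmxA addrA].
Qed.

Lemma affine_bij_inv g : affine_bij g ->
  exists h, [/\ affine_bij h, cancel g h & cancel h g].
Proof.
move=> [M [t [uM ->]]]; exists (fun x => x *m invmx M + - (t *m invmx M)).
split; first by exists (invmx M), (- (t *m invmx M)); rewrite unitmx_inv.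
  by move=> x; rewrite mulmxDl mulmxK // addrK.
by move=> x; rewrite mulmxDl mulNmx !mulmxKV // addrNK.
Qed.

Lemma mulmx_affine_bij (M : 'M[R]_n) : M \in unitmx -> affine_bij (mulmx^~ M).
Proof. by move=> uM; exists M, 0; split => //; apply/funext => x; rewrite addr0. Qed.

Lemma preimage_interior_sub (g : 'rV[R]_n -> 'rV[R]_n) A : continuous g ->
  g @^-1` A° `<=` (g @^-1` A)°.
Proof. by move=> cg x Ax; exact: cg Ax. Qed.

Lemma image_interior g A : affine_bij g -> (g @` A)° = g @` A°.
Proof.
move=> ag; have [h [ah gK hK]] := affine_bij_inv ag.
have E B : g @` B = h @^-1` B.
  apply/seteqP; split => [_ [x Bx <-]|y By]; first by rewrite /preimage /= gK.
  by exists (h y) => //; rewrite hK.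
have E' B : h @^-1` (g @^-1` B) = B.
  by rewrite /preimage; apply/seteqP; split=> y /=; rewrite hK.
rewrite !E; apply/seteqP; split=> y; last first.
  by apply: preimage_interior_sub; exact: affine_bij_continuous.
move=> Ay; rewrite /preimage /=.
have : (g @^-1` (h @^-1` A))° (h y).
  apply: preimage_interior_sub; first exact: affine_bij_continuous.
  by rewrite /preimage /= hK.
by apply: interiorS => z; rewrite /preimage /= gK.
Qed.

(** The ray [x + t *: e] tends to [x] as [t] decreases to 0. The bound [t <= 1] keeps the point on a
    segment when [e] is a difference of two points. *)
Lemma nbhs_ray x e A : nbhs x A -> exists t : R, 0 < t <= 1 /\ A (x + t *: e).
Proof.
move=> xA.
have c : (x + t *: e) @[t --> (0 : R)^'+] --> x.
  have : (x + t *: e) @[t --> (0 : R)^'+] --> x + 0 *: e.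
    apply: cvgD; first exact: cvg_cst.
    by apply: cvgZr_tmp; apply: cvg_at_right_filter; exact: cvg_id.
  by rewrite scale0r addr0.
suff : \forall t \near (0 : R)^'+, 0 < t <= 1 /\ A (x + t *: e) by move/filter_ex.
near=> t; split; last by near: t; exact: c.
by apply/andP; split; near: t; [exact: nbhs_right_gt|exact: nbhs_right_le].
Unshelve. all: by end_near. Qed.

Lemma hyperplane_interior (u : 'cV[R]_n) b : u != 0 ->
  [set x : 'rV[R]_n | (x *m u) 0 0 = b]° = set0.
Proof.
move=> u0; apply/seteqP; split=> // x xi.
have /= xb := interior_subset xi.
(* Moving in the normal direction [u^T] changes the linear form by [t] times the sum of squares of
   the entries of [u], which must then vanish. *)
have [t [/andP[t0 _] /=]] := nbhs_ray u^T xi.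
rewrite mulmxDl mxE xb -scalemxAl mxE => /eqP.
rewrite addrC -subr_eq0 addrK mulf_eq0 gt_eqF //= => /eqP s0.
have {}s0 : \sum_k u k 0 ^+ 2 = 0.
  by apply: etrans s0; rewrite mxE; apply: eq_bigr => i _; rewrite mxE expr2.
exfalso; move: u0 => /eqP; apply; apply/matrixP => i j; rewrite ord1 mxE.
apply/eqP; rewrite -sqrf_eq0; apply/eqP.
by apply: (psumr_eq0P _ s0) => // k _; exact: sqr_ge0.
Qed.

End Affine.

(** * Linear forms, finite intersections of half-spaces, and closed covers *)

Section Polyhedra.
Variables (R : realType) (n : nat).
Implicit Types (x y : 'rV[R]_n) (A B : set 'rV[R]_n).

Lemma lin_coord i : lin (fun x : 'rV[R]_n => x 0 i).
Proof.
exists (delta_mx i 0) => x; rewrite mxE (bigD1 i) //= mxE !eqxx mulr1 big1 ?addr0 //.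
by move=> j ji; rewrite mxE (negPf ji) mulr0.
Qed.

Lemma lin0 : lin (fun=> 0 : R) (n := n).
Proof. by exists 0 => x; rewrite mulmx0 mxE. Qed.

Lemma linD (f g : 'rV[R]_n -> R) : lin f -> lin g -> lin (fun x => f x + g x).
Proof. by move=> [u fu] [v gv]; exists (u + v) => x; rewrite mulmxDr mxE fu gv. Qed.

Lemma linZ a (f : 'rV[R]_n -> R) : lin f -> lin (fun x => a * f x).
Proof. by move=> [u fu]; exists (a *: u) => x; rewrite -scalemxAr mxE fu. Qed.

Lemma linB (f g : 'rV[R]_n -> R) : lin f -> lin g -> lin (fun x => f x - g x).
Proof.
move=> lf /(linZ (-1)) lg; have := linD lf lg.
by congr lin; apply/funext => x; rewrite mulN1r.
Qed.

Lemma lin_sum (I : Type) (s : seq I) (P : pred I) (f : I -> 'rV[R]_n -> R) :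
  (forall i, lin (f i)) -> lin (fun x => \sum_(i <- s | P i) f i x).
Proof.
move=> lf; elim: s => [|i s IH].
  by have := lin0; congr lin; apply/funext => x; rewrite big_nil.
case Pi : (P i); last by move: IH; congr lin; apply/funext => x; rewrite big_cons Pi.
by have := linD (lf i) IH; congr lin; apply/funext => x; rewrite big_cons Pi.
Qed.

Lemma lin_add f x y : lin f -> f (x + y) = f x + f y.
Proof. by move=> [u fu]; rewrite !fu mulmxDl mxE. Qed.

Lemma lin_scale f a x : lin f -> f (a *: x) = a * f x.
Proof. by move=> [u fu]; rewrite !fu -scalemxAl mxE. Qed.

Lemma lin_continuous (f : 'rV[R]_n -> R) : lin f -> continuous f.
Proof.
move=> [u fu]; have -> : f = (fun M : 'M[R]_(1, 1) => M 0 0) \o (mulmx^~ u).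
  by apply/funext => x; rewrite fu.
move=> x; apply: continuous_comp; first exact: mulmx_continuous.
exact: coord_continuous.
Qed.

Lemma level_interior (f : 'rV[R]_n -> R) b e : lin f -> f e != 0 ->
  [set x | f x = b]° = set0.
Proof.
move=> [u fu] fe; rewrite (_ : [set x | f x = b] = [set x | (x *m u) 0 0 = b]).
  apply: hyperplane_interior; apply: contraNneq fe => u0.
  by rewrite fu u0 mulmx0 mxE.
by apply/funext => x /=; rewrite fu.
Qed.

Lemma hpolyT : hpoly [set: 'rV[R]_n].
Proof. by exists [::]; apply/seteqP; split. Qed.

Lemma hpoly_le f b : lin f -> hpoly [set x : 'rV[R]_n | f x <= b].
Proof.
move=> [u fu]; exists [:: (u, b)]; apply/seteqP; split=> x /=.
  by move=> fx c; rewrite inE => /eqP -> /=; rewrite -fu.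
by rewrite fu => /(_ (u, b)); apply; rewrite inE.
Qed.

Lemma hpoly_ge f b : lin f -> hpoly [set x : 'rV[R]_n | b <= f x].
Proof.
move=> /(linZ (-1)) lf; have := hpoly_le (- b) lf; congr hpoly.
by apply/funext => x /=; rewrite mulN1r lerN2.
Qed.

Lemma hpolyI A B : hpoly A -> hpoly B -> hpoly (A `&` B).
Proof.
move=> [s ->] [t ->]; exists (s ++ t); apply/seteqP; split=> x /=.
  by move=> [As Bt] c; rewrite mem_cat => /orP[/As|/Bt].
by move=> H; split=> c cs; apply: H; rewrite mem_cat cs ?orbT.
Qed.

Lemma hpoly_forall (I : finType) (F : I -> set 'rV[R]_n) :
  (forall i, hpoly (F i)) -> hpoly [set x | forall i, F i x].
Proof.
move=> /choice[s Fs]; exists (flatten [seq s i | i <- enum I]).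
apply/seteqP; split=> x /= H.
  by move=> c /flattenP[_ /mapP[i _ ->] cs]; have := H i; rewrite Fs; apply.
move=> i; rewrite Fs => c cs; apply: H; apply/flattenP; exists (s i) => //.
by apply/mapP; exists i; rewrite ?mem_enum.
Qed.

Lemma hpoly_imp (b : bool) A : hpoly A -> hpoly [set x | b -> A x].
Proof.
case: b => [|_]; last by have := hpolyT; congr hpoly; apply/seteqP; split.
by congr hpoly; apply/seteqP; split=> x /=; [|exact].
Qed.

Lemma hpoly_preimage g A : affine_bij g -> hpoly A -> hpoly (g @^-1` A).
Proof.
move=> [M [t [_ ->]]] [s ->].
exists [seq (M *m c.1, c.2 - (t *m c.1) 0 0) | c <- s].
apply/seteqP; split=> x /= H c.
  move=> /mapP[d ds -> /=]; have /= := H d ds.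
  by rewrite mulmxA mulmxDl [fun_of_matrix (_ + _) _ _]mxE lerBrDr.
move=> cs; have /= := H _ (map_f _ cs).
by rewrite mulmxA mulmxDl [fun_of_matrix (_ + _) _ _]mxE lerBrDr.
Qed.

Lemma image_preimage_inv (g h : 'rV[R]_n -> 'rV[R]_n) A :
  cancel g h -> cancel h g -> g @` A = h @^-1` A.
Proof.
move=> gK hK; apply/seteqP; split=> [_ [x Ax <-]|y Ay]; first by rewrite /preimage /= gK.
by exists (h y) => //; rewrite hK.
Qed.

Lemma hpoly_image g A : affine_bij g -> hpoly A -> hpoly (g @` A).
Proof.
move=> ag pA; have [h [ah gK hK]] := affine_bij_inv ag.
by rewrite (image_preimage_inv _ gK hK); exact: hpoly_preimage.
Qed.

Lemma hpoly_closed A : hpoly A -> closed A.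
Proof.
move=> [s ->].
rewrite (_ : mkset _ = \bigcap_(c in [set` s])
    ((fun x : 'rV[R]_n => (x *m c.1) 0 0) @^-1` [set r | r <= c.2])).
  apply: closed_bigI => c _; apply: closed_comp; last exact: closed_le.
  by move=> x _; apply: lin_continuous; exists c.1.
by apply/seteqP; split=> x Hx c; exact: Hx.
Qed.

Definition convex A : Prop := forall x y (t : R),
  A x -> A y -> 0 <= t <= 1 -> A (x + t *: (y - x)).

Lemma hpoly_convex A : hpoly A -> convex A.
Proof.
move=> [s ->] x y t Ax Ay /andP[t0 t1] c cs.
have {}Ax := Ax c cs; have {}Ay := Ay c cs.
rewrite mulmxDl -scalemxAl mulmxBl !mxE.
rewrite !mxE in Ax Ay; nra.
Qed.

(** The homothety with centre [x] and small ratio [t] maps the convex set [A] into itself, so it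
    carries an interior point [y] to an interior point close to [x]. *)
Lemma closure_interior A x : convex A -> A° !=set0 -> A x -> closure A° x.
Proof.
move=> cA [y Ay] Ax B xB.
have [t [/andP[t0 t1] Bt]] := nbhs_ray (y - x) xB.
exists (x + t *: (y - x)); split=> //.
pose g z := x + t *: (z - x).
have ag : affine_bij g.
  exists (t%:M), (x - t *: x); split.
    by rewrite unitmxE det_scalar unitfE expf_neq0 // gt_eqF.
  by apply/funext => z; rewrite /g mul_mx_scalar scalerBr addrCA.
have : (g @` A)° (g y) by rewrite image_interior //; exists y.
apply: interiorS => _ [z Az <-]; apply: cA => //.
by rewrite (ltW t0).
Qed.

(** A finite form of Baire's theorem, by induction on the list: either [U] lies in the first closed
    set, or [U] minus that set is open, nonempty and covered by the others. *)
Lemma closed_cover_interior (T : topologicalType) (I : eqType) (s : seq I)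
    (F : I -> set T) (U : set T) :
  (forall i, closed (F i)) -> open U -> U !=set0 ->
  U `<=` [set x | exists2 i, i \in s & F i x] ->
  exists i, (F i)° `&` U !=set0.
Proof.
move=> cF; elim: s U => [|i s IH] U oU [x Ux] UF.
  by have [] := UF x Ux.
have [UFi|/existsNP[y /not_implyP[Uy nFy]]] := pselect (U `<=` F i).
  by rewrite open_subsetE // in UFi; exists i, x; split=> //; exact: UFi.
have [|||j [z [Fz [Uz _]]]] := IH (U `&` ~` F i).
- by apply: openI => //; exact: closed_openC.
- by exists y.
- move=> z [Uz nFz]; have [j] := UF z Uz.
  by rewrite inE => /predU1P[->|js Fj] //; exists j.
by exists j, z.
Qed.

(** If the pieces with interior left out a point of [A], they would leave out a nonempty open part
    of its interior. This part is covered by finitely many closed pieces, so one piece has interior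
    points inside it, a contradiction. *)
Lemma cover_drop (I : finType) (F : I -> set 'rV[R]_n) A :
  convex A -> A° !=set0 -> (forall i, closed (F i)) -> A = \bigcup_i F i ->
  A = \bigcup_(i in [set i | (F i)° !=set0]) F i.
Proof.
move=> cA A0 cF AF; apply/seteqP; split=> [x Ax|x [i _ Fx]]; last first.
  by rewrite AF; exists i.
apply: contrapT => nBx; set B := \bigcup_(i in _) _ in nBx.
have cB : closed B by apply: closed_bigcup => [|i _]; [exact: finite_finset|exact: cF].
have [z [Az Bz]] : (A° `&` ~` B) !=set0.
  apply: (closure_interior cA A0 Ax); apply: open_nbhs_nbhs; split=> //.
  exact: closed_openC.
have [i [y [Fy [_ By]]]] : exists i, (F i)° `&` (A° `&` ~` B) !=set0.
  apply: (@closed_cover_interior _ _ (enum I)) => //.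
  - by apply: openI; [exact: open_interior|exact: closed_openC].
  - by exists z.
  - move=> y [/interior_subset + _]; rewrite AF => -[i _ Fy].
    by exists i; rewrite ?mem_enum.
apply: By; exists i; last exact: interior_subset.
by exists y.
Qed.

End Polyhedra.

(** * Finitely generated convex sets and their sections by half-spaces *)

Section Hulls.
Variables (R : realType) (n : nat).
Implicit Types (x y : 'rV[R]_n) (A B : set 'rV[R]_n).

Lemma hull_linear_comb m (p : 'I_m -> 'rV[R]_n) (c : 'I_m -> R) (u : 'cV[R]_n) :
  ((\sum_i c i *: p i) *m u) 0 0 = \sum_i c i * ((p i *m u) 0 0) :> R.
Proof.
by rewrite mulmx_suml summxE; apply: eq_bigr => i _; rewrite -scalemxAl mxE.
Qed.

Lemma hpoly_hull_sub A m (p : 'I_m -> 'rV[R]_n) :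
  hpoly A -> (forall i, A (p i)) -> convex_hull p `<=` A.
Proof.
move=> [s ->] Ap _ [c [c0 c1 ->]] d ds.
rewrite hull_linear_comb -[leRHS]mul1r -c1 mulr_suml.
by apply: ler_sum => i _; apply: ler_wpM2l => //; exact: Ap.
Qed.

(** For convex [A] this says that [A] is the hull of the points. The value [m = 0] is allowed and
    gives the empty set. *)
Definition fingen A : Prop := exists (m : nat) (p : 'I_m -> 'rV[R]_n),
  (forall i, A (p i)) /\ A `<=` convex_hull p.

Lemma fingen_fintype (I : finType) (q : I -> 'rV[R]_n) A :
  (forall i, A (q i)) ->
  (forall x, A x -> exists c : I -> R, [/\ forall i, 0 <= c i, \sum_i c i = 1
                                         & x = \sum_i c i *: q i]) ->
  fingen A.
Proof.
move=> Aq Ac; exists #|I|, (fun k => q (enum_val k)); split=> // x /Ac.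
move=> [c [c0 c1 ->]]; exists (fun k => c (enum_val k)); split=> //.
  by rewrite -c1 [RHS](big_enum_val (A := I)).
by rewrite [LHS](big_enum_val (A := I)).
Qed.

(* The mass [c i * d i] on the positive side is transported to the negative side
   proportionally to [c j * - d j]; each pair (i, j) yields a point of the hyperplane. *)
Lemma transport_sum (V : lmodType R) (I : finType) (pos : pred I) (c d : I -> R)
    (P : I -> V) (T : R) : T = \sum_(j | ~~ pos j) c j * - d j -> T != 0 ->
  \sum_(i | pos i) \sum_(j | ~~ pos j)
      (c i * c j / T) *: (- d j *: P i + d i *: P j)
  = \sum_(i | pos i) c i *: P i
    + ((\sum_(i | pos i) c i * d i) / T) *: \sum_(j | ~~ pos j) c j *: P j.
Proof.
move=> TE T0; under eq_bigr do under eq_bigr do rewrite scalerDr !scalerA.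
under eq_bigr do rewrite big_split /= -scaler_suml.
rewrite big_split /=; congr (_ + _).
  apply: eq_bigr => i _; congr (_ *: _).
  rewrite (eq_bigr (fun j => c i / T * (c j * - d j))); last by move=> j _; ring.
  by rewrite -mulr_sumr -TE divfK.
rewrite exchange_big scaler_sumr /=; apply: eq_bigr => j _.
rewrite scalerA -scaler_suml; congr (_ *: _).
by rewrite !mulr_suml; apply: eq_bigr => i _; ring.
Qed.

(** The new generators are the old ones in the half-space together with the points where segments
    from a generator outside to a generator inside cross the hyperplane [f = b]. *)
Lemma fingen_half A f b : convex A -> fingen A -> lin f ->
  fingen (A `&` [set x | f x <= b]).
Proof.
move=> cA [m [p [Ap Ah]]] lf; set C := _ `&` _.
have [C0|/set0P[x0 Cx0]] := eqVneq C set0.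
  by rewrite C0; exists 0%N, (fun=> 0); split=> // -[].
pose d i := f (p i) - b; pose pos i := 0 < d i.
(* Indices that yield no generator get the default value [x0], which lies in [C]; they receive
   weight 0 below. *)
pose q (k : 'I_m + 'I_m * 'I_m) := match k with
  | inl i => if pos i then x0 else p i
  | inr (i, j) => if pos i && ~~ pos j then
      p i + (d i / (d i - d j)) *: (p j - p i) else x0
  end.
apply: (@fingen_fintype _ q) => [[i|[i j]] /=|x [Ax fx]].
- case: ifPn => // npi; split=> //=.
  by move: npi; rewrite /pos /d -leNgt subr_le0.
- case: ifPn => // /andP[pi npj].
  rewrite /pos -leNgt in npj; rewrite /pos in pi.
  have dd : 0 < d i - d j by rewrite subr_gt0 (le_lt_trans npj).
  split; first (apply: cA => //; apply/andP; split).
  + by rewrite divr_ge0 // ltW.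
  + by rewrite ler_pdivrMr // mul1r lerBrDr gerDl.
  + rewrite /= (lin_add _ _ lf) (lin_scale _ _ lf) (lin_add _ _ lf) -(scaleN1r (p i))
      (lin_scale _ _ lf).
    have -> : f (p i) = d i + b by rewrite /d subrK.
    have -> : f (p j) = d j + b by rewrite /d subrK.
    suff -> : d i + b + d i / (d i - d j) * (d j + b + -1 * (d i + b)) = b by [].
    by field; rewrite gt_eqF.
have [c [c0 c1 xE]] := Ah x Ax.
have cd : \sum_i c i * d i <= 0.
  rewrite (eq_bigr (fun i => c i * f (p i) - c i * b)); last first.
    by move=> i _; rewrite mulrBr.
  rewrite sumrB -mulr_suml c1 mul1r subr_le0; apply: le_trans fx.
  case: lf => u fu; rewrite fu xE hull_linear_comb.
  by apply: ler_sum => i _; rewrite fu.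
(* [S] is the total excess over [b] and [T] the total deficit; [f x <= b] gives [S <= T]. *)
pose S := \sum_(i | pos i) c i * d i.
pose T := \sum_(i | ~~ pos i) c i * - d i.
have ST : S <= T.
  move: cd; rewrite (bigID pos) /= -/S -lerBrDr sub0r => /le_trans; apply.
  by rewrite -sumrN; apply: ler_sum => i _; rewrite mulrN.
have cd0 i : pos i -> 0 <= c i * d i by move=> pi; rewrite mulr_ge0 // ltW.
have S0 : 0 <= S by apply: sumr_ge0.
have [SE|Sn0] := eqVneq S 0.
  have cE i : pos i -> c i = 0.
    move=> pi; have /eqP := psumr_eq0P cd0 SE pi.
    by rewrite mulf_eq0 (gt_eqF pi) orbF => /eqP.
  exists (fun k => if k is inl i then c i else 0); split.
  - by case.
  - by rewrite big_sumType /= [X in _ + X]big1 // addr0.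
  rewrite big_sumType /= [X in _ + X]big1; last by move=> ij _; rewrite scale0r.
  rewrite addr0 xE; apply: eq_bigr => i _; case: ifP => // pi.
  by rewrite cE // !scale0r.
have Tgt0 : 0 < T by apply: lt_le_trans ST; rewrite lt_neqAle eq_sym Sn0.
have T0 : T != 0 by rewrite gt_eqF.
(* The crossing points absorb all the mass outside and the fraction [S / T] of the mass inside; the
   remaining fraction stays on the old generators. *)
pose w (k : 'I_m + 'I_m * 'I_m) := match k with
  | inl i => if pos i then 0 else c i * (1 - S / T)
  | inr (i, j) => if pos i && ~~ pos j then c i * c j * (d i - d j) / T else 0
  end.
(* Stated for any module so that it serves twice: with constant values 1 it shows that the weights
   sum to 1, with the generators that they represent [x]. *)
have wsum (V : lmodType R) (P : 'I_m -> V) (Q : 'I_m + 'I_m * 'I_m -> V) :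
    (forall i, ~~ pos i -> Q (inl i) = P i) ->
    (forall i j, pos i -> ~~ pos j -> (d i - d j) *: Q (inr (i, j)) =
       - d j *: P i + d i *: P j) ->
    \sum_k w k *: Q k = \sum_i c i *: P i.
  move=> Ql Qr; rewrite big_sumType /= [RHS](bigID pos) /=.
  have -> : \sum_i w (inl i) *: Q (inl i) =
      (1 - S / T) *: \sum_(i | ~~ pos i) c i *: P i.
    rewrite scaler_sumr [RHS]big_mkcond /=; apply: eq_bigr => i _.
    case pi : (pos i) => /=; first by rewrite scale0r.
    by rewrite Ql ?pi // scalerA mulrC.
  have -> : \sum_(k : 'I_m * 'I_m) w (inr k) *: Q (inr k) =
     \sum_(i | pos i) \sum_(j | ~~ pos j)
      (c i * c j / T) *: (- d j *: P i + d i *: P j).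
    rewrite pair_big /= [RHS]big_mkcond /=; apply: eq_bigr => -[i j] _ /=.
    case: ifP => [/andP[pi npj]|]; last by rewrite scale0r.
    by rewrite -Qr // scalerA; congr (_ *: _); ring.
  by rewrite (transport_sum _ _ T0) // scalerBl scale1r addrC -addrA
    [X in _ + X]addrC subrK.
exists w; split.
- move=> [i|[i j]] /=; case: ifP => //.
    move=> _; rewrite mulr_ge0 // subr_ge0 ler_pdivrMr // mul1r //.
  move=> /andP[pi]; rewrite /pos -leNgt => dj.
  rewrite divr_ge0 // ?(ltW Tgt0) // mulr_ge0 ?mulr_ge0 // subr_ge0.
  by rewrite (le_trans dj) // ltW.
- rewrite -[RHS]c1; have /= := wsum R^o (fun=> 1) (fun=> 1).
  have E (J : finType) (F : J -> R) : \sum_k F k *: (1 : R^o) = \sum_k F k.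
    by apply: eq_bigr => k _; exact: mulr1.
  rewrite !E; apply=> // i j _ _; rewrite /GRing.scale /= !mulr1; ring.
rewrite xE; apply/esym/wsum => [i|i j pi npj] /=; first by move/negPf ->.
rewrite pi npj /= scalerDr scalerA mulrCA divff ?mulr1; last first.
  by rewrite gt_eqF // subr_gt0; apply: le_lt_trans pi; rewrite leNgt.
by rewrite scalerBl scalerBr addrC addrA subrK addrC scaleNr.
Qed.

End Hulls.

(** * Caratheodory's theorem and triangulation into full-dimensional simplices *)

Section Caratheodory.
Variables (R : realType) (n : nat).
Implicit Types (x y : 'rV[R]_n) (A B : set 'rV[R]_n).

Lemma hpoly_fingen A B : hpoly B -> fingen B -> hpoly A -> A `<=` B -> fingen A.
Proof.
move=> hB fB [s AE] AB.
suff : fingen (B `&` A) by rewrite setIC; move/setIidPl: AB => ->.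
rewrite {A}AE in AB *; elim: s {AB} => [|c s IH].
  by rewrite (_ : B `&` _ = B) //; apply/seteqP; split=> [x []|x Bx].
have lc : lin (fun x : 'rV[R]_n => (x *m c.1) 0 0) by exists c.1.
have hs : hpoly [set x : 'rV[R]_n | forall d, d \in s -> (x *m d.1) 0 0 <= d.2].
  by exists s.
have := fingen_half c.2 (hpoly_convex (hpolyI hB hs)) IH lc.
congr fingen; apply/seteqP; split=> x /=.
  move=> [[Bx sx] cx]; split=> // d; rewrite inE => /predU1P[->|] //; exact: sx.
move=> [Bx csx]; split; last by apply: csx; rewrite inE eqxx.
by split=> // d ds; apply: csx; rewrite inE ds orbT.
Qed.

Section Points.
Variables (m : nat) (p : 'I_m -> 'rV[R]_n).

(** Affine independence of a subfamily, with coefficients supported on [I], so that [I] can be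
    enlarged or shrunk without reindexing. *)
Definition indep_on (I : {set 'I_m}) : Prop := forall c : 'I_m -> R,
  (forall i, i \notin I -> c i = 0) ->
  \sum_i c i = 0 -> \sum_i c i *: p i = 0 -> forall i, c i = 0.

Lemma indep_on_affine_indep (I : {set 'I_m}) N (e : 'I_N -> 'I_m) :
  indep_on I -> injective e -> (forall k, e k \in I) ->
  affine_indep (fun k => p (e k)).
Proof.
move=> iI inj_e eI c c0 cp0 k.
pose C i := \sum_(k | e k == i) c k.
have CE j : C (e j) = c j.
  by rewrite /C (eq_bigl (pred1 j)) ?big_pred1_eq // => l; rewrite /= (inj_eq inj_e).
rewrite -CE; apply: iI => [i iI||].
- rewrite /C big1 // => l /eqP li; case/negP: iI; by rewrite -li.
- rewrite -[RHS]c0 (partition_big e predT) //=.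
- rewrite -[RHS]cp0 (partition_big e predT) //=; apply: eq_bigr => i _.
  by rewrite /C scaler_suml; apply: eq_bigr => l /eqP ->.
Qed.

(** Take a support [I] of minimal size under inclusion. A nontrivial affine dependence on [I] could
    be subtracted until a coefficient vanishes, giving a smaller support. *)
Lemma hull_indep_support x : convex_hull p x ->
  exists (I : {set 'I_m}) (c : 'I_m -> R), indep_on I /\
  [/\ forall i, 0 <= c i, \sum_i c i = 1, x = \sum_i c i *: p i
    & forall i, i \notin I -> c i = 0].
Proof.
pose Psi (J : {set 'I_m}) (c : 'I_m -> R) :=
  [/\ forall i, 0 <= c i, \sum_i c i = 1, x = \sum_i c i *: p i
    & forall i, i \notin J -> c i = 0].
move=> [c0 [c00 c01 xc0]].
have PT : `[< exists c, Psi [set: 'I_m]%SET c >].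
  by apply/asboolP; exists c0; split=> // i; rewrite inE.
have [I /minsetP[/asboolP[c Pc] Imin] _] :=
  minset_exists (P := fun J => `[< exists c, Psi J c >]) PT.
exists I, c; split; last exact: Pc.
move: Pc => [cge0 c1 xE cI] e eI e0 ep0 i0.
apply: contrapT => /eqP ei0.
have [k ek] : exists k, 0 < e k.
  apply: contrapT => /forallNP ne; have {}ne k : e k <= 0.
    by rewrite leNgt; apply/negP; exact: ne.
  move: ei0; rewrite -oppr_eq0 (psumr_eq0P (P := predT) (F := fun k => - e k)) ?eqxx //.
    by move=> i _; rewrite oppr_ge0.
  by rewrite sumrN e0 oppr0.
(* The least ratio [c i / e i] over positive [e i] is the largest multiple of [e] that can be
   subtracted with all coefficients staying nonnegative. *)
have [j ej jmin] := @arg_minP _ _ _ k (fun i => 0 < e i) (fun i => c i / e i) ek.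
pose t := c j / e j; pose c' i := c i - t * e i.
have t0 : 0 <= t by rewrite divr_ge0 // ltW.
have cj : c' j = 0 by rewrite /c' /t divfK ?subrr // gt_eqF.
have ejI : j \in I by apply: contraTT ej => /eI ->; rewrite ltxx.
suff P' : Psi (I :\ j) c'.
  have E : (I :\ j)%SET = I.
    by apply: Imin; [apply/asboolP; exists c'|exact: subD1set].
  by move: ejI; rewrite -E !inE eqxx.
split.
- move=> i; rewrite /c' subr_ge0; have [ei|ei] := ltP 0 (e i).
    by rewrite -ler_pdivlMr //; exact: jmin.
  by apply: le_trans (cge0 i); rewrite mulr_ge0_le0.
- by rewrite sumrB -mulr_sumr e0 mulr0 subr0.
- rewrite xE; under [RHS]eq_bigr do rewrite scalerBl -scalerA.
  by rewrite sumrB -scaler_sumr ep0 scaler0 subr0.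
- move=> i; rewrite !inE negb_and negbK => /orP[/eqP->//|iI].
  by rewrite /c' cI // eI // mulr0 subr0.
Qed.

Lemma maximal_indep (I : {set 'I_m}) : indep_on I -> exists J : {set 'I_m},
  [/\ I \subset J, indep_on J & forall j, j \notin J -> ~ indep_on (j |: J)].
Proof.
move=> iI; have PI : `[< indep_on I >] by apply/asboolP.
have [J /maxsetP[/asboolP iJ Jmax] IJ] :=
  maxset_exists (P := fun J => `[< indep_on J >]) PI.
exists J; split=> // j jJ ijJ; case/negP: jJ.
have <- : (j |: J)%SET = J by apply: Jmax; [apply/asboolP|exact: finset.subsetUr].
exact: setU11.
Qed.

(** By maximality every further point is an affine combination of the points in [J], so an affine
    condition on [J] propagates to it. *)
Lemma maximal_indep_affine_zero (J : {set 'I_m}) (u : 'cV[R]_n) b :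
  (forall j, j \notin J -> ~ indep_on (j |: J)) -> indep_on J ->
  (forall i, i \in J -> (p i *m u) 0 0 = b) -> forall i, (p i *m u) 0 0 = b.
Proof.
move=> Jmax iJ Ju j; have [/Ju //|jJ] := boolP (j \in J).
have /existsNP[c /not_implyP[cJ /not_implyP[c0 /not_implyP[cp0 /existsNP[k ck]]]]]
  := Jmax j jJ.
have cj : c j != 0.
  apply/eqP => cj0; apply: ck; apply: iJ => // i iJ.
  have [->//|ij] := eqVneq i j.
  by apply: cJ; rewrite !inE negb_or ij.
have : \sum_i c i * ((p i *m u) 0 0 - b) = 0.
  rewrite (eq_bigr (fun i => c i * (p i *m u) 0 0 - c i * b)); last first.
    by move=> i _; rewrite mulrBr.
  by rewrite sumrB -mulr_suml c0 mul0r subr0 -hull_linear_comb cp0 mul0mx mxE.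
rewrite (bigD1 j) //= big1 ?addr0 => [/eqP|i ij].
  by rewrite mulf_eq0 (negPf cj) subr_eq0 => /eqP.
have [/Ju->|iJ'] := boolP (i \in J); first by rewrite subrr mulr0.
by rewrite cJ ?mul0r // !inE negb_or ij.
Qed.

(** Homogenize: the rows [(1, p k)] for [k] in [J] are linearly independent, and they span because a
    vector orthogonal to all of them would put the whole hull in a hyperplane. Hence they form a
    basis of a space of dimension [n + 1]. *)
Lemma maximal_indep_card (J : {set 'I_m}) : (convex_hull p)° !=set0 ->
  (forall j, j \notin J -> ~ indep_on (j |: J)) -> indep_on J -> #|J| = n.+1.
Proof.
move=> [x xi] Jmax iJ.
pose M := \matrix_(k < #|J|) row_mx (1%:M : 'M[R]_1) (p (enum_val k)).
have rM k : row k M = row_mx 1%:M (p (enum_val k)) by rewrite rowK.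
have ME (z : 'cV[R]_(1 + n)) k : (M *m z) k 0 =
    z 0 0 + (p (enum_val k) *m dsubmx z) 0 0.
  transitivity ((row k M *m z) 0 0); first by rewrite -row_mul [RHS]mxE.
  rewrite rM -{1}[z]vsubmxK mul_row_col mul1mx mxE; congr (_ + _).
  by rewrite mxE; congr (z _ _); apply/val_inj.
have fM : row_free M.
  apply: inj_row_free => v vM; apply/rowP => k; rewrite mxE.
  have vE : \sum_k v 0 k *: row_mx (1%:M : 'M[R]_1) (p (enum_val k)) = 0.
    by rewrite -[RHS]vM mulmx_sum_row; apply: eq_bigr => l _; rewrite rM.
  have ai : affine_indep (fun k : 'I_#|J| => p (enum_val k)).
    exact: (indep_on_affine_indep (e := fun k : 'I_#|J| => enum_val k) iJ
      (@enum_val_inj _ _) (fun k => enum_valP k)).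
  apply: ai.
    move/(congr1 (fun z => lsubmx z 0 0)): vE; rewrite linear_sum summxE /=.
    rewrite linear0 mxE => H; apply: etrans H; apply: eq_bigr => l _.
    by rewrite linearZ /= row_mxKl !mxE mulr1.
  move/(congr1 rsubmx): vE; rewrite linear_sum /= linear0 => H.
  by apply: etrans H; apply: eq_bigr => l _; rewrite linearZ /= row_mxKr.
have gM : row_full M.
  rewrite -cokermx_eq0; apply/eqP/matrixP => i j; rewrite [RHS]mxE.
  apply: contrapT => nz; pose z := col j (cokermx M).
  have Mz : M *m z = 0 by rewrite /z colE mulmxA mulmx_coker mul0mx.
  have zJ k : k \in J -> (p k *m dsubmx z) 0 0 = - z 0 0.
    move=> kJ; have := ME z (enum_rank_in kJ k); rewrite Mz mxE enum_rankK_in // => /eqP.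
    by rewrite eq_sym addrC addr_eq0 => /eqP.
  have zp := maximal_indep_affine_zero Jmax iJ zJ.
  have hz y : convex_hull p y -> (y *m dsubmx z) 0 0 = - z 0 0.
    move=> [c [_ c1 ->]]; rewrite hull_linear_comb.
    by under eq_bigr do rewrite zp; rewrite -mulr_suml c1 mul1r.
  (* If the linear part of the affine equation is 0, its constant term is 0 as well and [z]
     vanishes; otherwise the equation defines a true hyperplane. *)
  have [u0|u0] := eqVneq (dsubmx z) 0.
    have := hz x (interior_subset xi); rewrite u0 mulmx0 mxE => /eqP.
    rewrite eq_sym oppr_eq0 => /eqP z0; apply: nz.
    have uz : usubmx z = 0.
      apply/matrixP => a c; rewrite !ord1 [RHS]mxE -[RHS]z0 mxE.
      by congr (z _ _); apply/val_inj.
    have : z = 0 by rewrite -[z]vsubmxK uz u0 col_mx0.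
    by move/(congr1 (fun t : 'cV_(1 + n) => t i 0)); rewrite !mxE.
  have : [set y : 'rV[R]_n | (y *m dsubmx z) 0 0 = - z 0 0]° x.
    by move: xi; apply: interiorS => y; exact: hz.
  by rewrite hyperplane_interior.
by move: fM gM; rewrite /row_free /row_full => /eqP rf /eqP; rewrite rf add1n.
Qed.

(** An independent support of [x] is enlarged to a maximal one, which has [n + 1] elements. The
    vertices are indexed by a finite function so that only finitely many simplices occur. *)
Lemma hull_in_simplex x : (convex_hull p)° !=set0 -> convex_hull p x ->
  exists e : {ffun 'I_n.+1 -> 'I_m},
    affine_indep (fun k => p (e k)) /\ convex_hull (fun k => p (e k)) x.
Proof.
move=> i0 /hull_indep_support[I [c [iI [c0 c1 xE cI]]]].
have [J [IJ iJ Jmax]] := maximal_indep iI.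
have cardJ := maximal_indep_card i0 Jmax iJ.
pose e k : 'I_m := enum_val (cast_ord (esym cardJ) k).
have esum (V : zmodType) (F : 'I_m -> V) :
    \sum_(i in J) F i = \sum_k F (e k).
  rewrite big_enum_val (reindex (cast_ord (esym cardJ))) //.
  by exists (cast_ord cardJ) => k _; rewrite ?cast_ordK ?cast_ordKV.
have csum (V : lmodType R) (F : 'I_m -> V) :
    \sum_i c i *: F i = \sum_k c (e k) *: F (e k).
  rewrite -(esum _ (fun i => c i *: F i)) [RHS]big_mkcond; apply: eq_bigr => i _.
  by case: ifPn => // iJ'; rewrite cI ?scale0r //; apply: contraNN iJ'; exact: (fintype.subsetP IJ).
exists (finfun e); split.
  have -> : (fun k => p (finfun e k)) = (fun k => p (e k)).
    by apply/funext => k; rewrite ffunE.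
  apply: (indep_on_affine_indep iJ) => [k l /enum_val_inj/cast_ord_inj //|k].
  exact: enum_valP.
exists (fun k => c (e k)); split=> //.
  rewrite -c1; have E (L : finType) (F : L -> R) : \sum_k F k *: (1 : R^o) = \sum_k F k.
    by apply: eq_bigr => k _; exact: mulr1.
  by rewrite -[RHS]E (csum _ (fun=> 1 : R^o)) E.
by rewrite xE csum; apply: eq_bigr => k _; rewrite ffunE.
Qed.

End Points.

Lemma fingen_polytope A : hpoly A -> fingen A -> A° !=set0 -> polytope A.
Proof.
move=> hA [m [p [Ap Ah]]] [x Ax].
have AE : A = convex_hull p.
  by apply/seteqP; split => //; exact: hpoly_hull_sub.
(* [A] is the union of all nondegenerate simplices spanned by its generators; their overlaps are
   harmless. *)
pose E : {set {ffun 'I_n.+1 -> 'I_m}} :=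
  [set e : {ffun 'I_n.+1 -> 'I_m} | `[< affine_indep (fun k => p (e k)) >]]%SET.
have i0 : (convex_hull p)° !=set0 by exists x; rewrite -AE.
have inE' y : A y -> exists2 e, e \in E & convex_hull (fun k => p (e k)) y.
  rewrite AE => /(hull_in_simplex i0)[e [ei ey]]; exists e => //.
  by rewrite inE; apply/asboolP.
have [e0 e0E _] := inE' x (interior_subset Ax).
have cE : #|E| = #|E|.-1.+1 by rewrite prednK //; apply/card_gt0P; exists e0.
exists #|E|.-1, (fun j => convex_hull (fun k => p (enum_val (cast_ord (esym cE) j) k))).
split.
  move=> j; set e := enum_val _; exists (fun k => p (e k)); split=> //.
  by have := enum_valP (cast_ord (esym cE) j); rewrite inE => /asboolP.
apply/seteqP; split=> y.
  move=> /inE'[e eE ey]; exists (cast_ord cE (enum_rank_in eE e)) => //.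
  by rewrite cast_ordK enum_rankK_in.
by move=> [j _]; apply: hpoly_hull_sub.
Qed.

End Caratheodory.

(** * Equidissection relative to a class of motions *)

Section Equidissection.
Variables (R : realType) (n : nat) (iso : ('rV[R]_n -> 'rV[R]_n) -> Prop).
Hypothesis iso_id : iso id.
Hypothesis iso_comp : forall g h, iso g -> iso h -> iso (g \o h).
Implicit Types (x y : 'rV[R]_n) (A B : set 'rV[R]_n).

Definition dissected (I : finType) A (P : I -> set 'rV[R]_n) : Prop :=
  A = \bigcup_i P i /\ trivIset setT (fun i => (P i)°).

Definition equidissectable N A B : Prop :=
  exists (I : finType) (P : I -> set 'rV[R]_n) (g : I -> 'rV[R]_n -> 'rV[R]_n),
  [/\ (#|I| <= N)%N, forall i, hpoly (P i),
      forall i, affine_bij (g i) /\ iso (g i),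
      dissected A P & dissected B (fun i => g i @` P i)].

Lemma affine_bij_inj (g : 'rV[R]_n -> 'rV[R]_n) : affine_bij g -> injective g.
Proof. by move=> /affine_bij_inv[h [_ gK _]]; exact: can_inj gK. Qed.

Lemma interior_preimage (g : 'rV[R]_n -> 'rV[R]_n) A x : affine_bij g ->
  (g @^-1` A)° x -> A° (g x).
Proof.
move=> ag Ax; have : (g @` (g @^-1` A))° (g x) by rewrite image_interior //; exists x.
by apply: interiorS => _ [y Ay <-].
Qed.

Lemma equidissectable_refl A : hpoly A -> equidissectable 1 A A.
Proof.
have D : dissected A (fun _ : unit => A).
  split; last by move=> [] [].
  by apply/seteqP; split=> [x Ax|x [i _]] //; exists tt.
exists unit, (fun=> A), (fun=> id); split=> //.
- by rewrite card_unit.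
- by move=> _; split=> //; exact: affine_bij_id.
by rewrite image_id.
Qed.

(** The common refinement: the pieces are [P i] cut by the preimages of the [Q j], at most one for
    each pair [(i, j)]. *)
Lemma equidissectable_trans N M A B C :
  equidissectable N A B -> equidissectable M B C -> equidissectable (N * M) A C.
Proof.
move=> [I [P [g [cI hP ag [AE tP] [BE tgP]]]]].
move=> [J [Q [h [cJ hQ ah [BE' tQ] [CE thQ]]]]].
pose S (k : I * J) := P k.1 `&` g k.1 @^-1` Q k.2.
exists (I * J)%type, S, (fun k => h k.2 \o g k.1); split.
- by rewrite card_prod leq_mul.
- by move=> k; apply: hpolyI => //; apply: hpoly_preimage => //; case: (ag k.1).
- move=> k; have [a1 i1] := ag k.1; have [a2 i2] := ah k.2.
  by split; [exact: affine_bij_comp|exact: iso_comp].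
- split.
    apply/seteqP; split=> [x Ax|x [k _ [Pk _]]]; last by rewrite AE; exists k.1.
    have := Ax; rewrite AE => -[i _ Px].
    have : B (g i x) by rewrite BE; exists i => //; exists x.
    by rewrite BE' => -[j _ Qx]; exists (i, j).
  move=> [i j] [i' j'] _ _ [x [/= xS xS']].
  have ii' : i = i'.
    apply: tP => //; exists x; split; first by move: xS; apply: interiorS => z [].
    by move: xS'; apply: interiorS => z [].
  congr (_, _) => //; rewrite -{}ii' in xS'; have [agi _] := ag i.
  apply: tQ => //; exists (g i x); split; apply: interior_preimage => //.
    by move: xS; apply: interiorS => z [].
  by move: xS'; apply: interiorS => z [].
split.
  apply/seteqP; split=> [y|y [k _ [x [Px Qx] <-]]]; last first.
    by rewrite CE; exists k.2 => //=; exists (g k.1 x).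
  rewrite CE => -[j _ [z Qz <-]]; have : B z by rewrite BE'; exists j.
  rewrite BE => -[i _ [x Px xz]]; exists (i, j) => //; exists x; last by rewrite /= xz.
  by split=> //=; rewrite /preimage /= xz.
move=> [i j] [i' j'] _ _ [y [/= yS yS']].
have jj' : j = j'.
  apply: thQ => //; exists y; split.
    by move: yS; apply: interiorS => _ [x [_ Qx] <-]; exists (g i x).
  by move: yS'; apply: interiorS => _ [x [_ Qx] <-]; exists (g i' x).
congr (_, _) => //; rewrite -{}jj' in yS'; have [ahj _] := ah j.
have H k : ((h j \o g k) @` S (k, j))° y -> (h j @` (g k @` P k)°) y.
  rewrite -image_interior //; apply: interiorS => _ [x [Px _] <-].
  by exists (g k x) => //; exists x.
have [z zP zy] := H _ yS; have [z' zP' zy'] := H _ yS'.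
apply: tgP => //; exists z; split=> //.
by rewrite (affine_bij_inj ahj (etrans zy (esym zy'))).
Qed.

End Equidissection.

(** * Helmert coordinates and the chain of regions from brick to simplex *)

Section Coordinates.
Variables (R : realType) (n : nat).
Implicit Types (x y : 'rV[R]_n).

(* Coordinates extended by zero to all indices, so that [ext x n = 0] closes the chain. *)
Definition ext x (j : nat) : R := if insub j is Some i then x 0 i else 0.

Definition helm (m : nat) x : R := \sum_(i < m) ext x i - m%:R * ext x m.

(** The set [A_m] of the overview; [region 0] bounds all the forms [helm j] and becomes the brick,
    [region n] is the simplex in the basis [v]. *)
Definition region (m : nat) : set 'rV[R]_n := [set x |
  [/\ forall j, (j < n.+1)%N -> (m < j)%N -> 0 <= helm j x <= 1,
      forall i, (i < m)%N -> ext x i.+1 <= ext x i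
    & ext x 0 - ext x m <= 1]].

Lemma ext_ord x (i : 'I_n) : ext x i = x 0 i.
Proof. by rewrite /ext valK. Qed.

Lemma ext_ge x j : (n <= j)%N -> ext x j = 0.
Proof. by move=> nj; rewrite /ext insubN // -leqNgt. Qed.

Lemma lin_ext j : lin (fun x => ext x j).
Proof.
have [jn|nj] := ltnP j n.
  by have := lin_coord R (Ordinal jn); congr lin; apply/funext => x; rewrite -ext_ord.
by have := lin0 R n; congr lin; apply/funext => x; rewrite ext_ge.
Qed.

Lemma lin_helm m : lin (helm m).
Proof. by apply: linB; [apply: lin_sum => i; exact: lin_ext|apply: linZ; exact: lin_ext]. Qed.

Lemma hpoly_forall_lt N (F : nat -> set 'rV[R]_n) :
  (forall i, hpoly (F i)) -> hpoly [set x | forall i, (i < N)%N -> F i x].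
Proof.
move=> hF; have := hpoly_forall (fun i : 'I_N => hF i); congr hpoly.
apply/seteqP; split=> x /= H i => [iN|]; first exact: (H (Ordinal iN)).
exact: H.
Qed.

Lemma hpoly_region m : hpoly (region m).
Proof.
have h1 : hpoly [set x | forall j, (j < n.+1)%N -> (m < j)%N -> 0 <= helm j x <= 1].
  apply: (@hpoly_forall_lt _ (fun j => [set x | (m < j)%N -> 0 <= helm j x <= 1])) => j.
  apply: hpoly_imp; have := hpolyI (hpoly_ge 0 (lin_helm j)) (hpoly_le 1 (lin_helm j)).
  by congr hpoly; apply/seteqP; split=> x /= => [[-> ->]|/andP[]].
have h2 : hpoly [set x | forall i, (i < m)%N -> ext x i.+1 <= ext x i].
  apply: (@hpoly_forall_lt _ (fun i => [set x | ext x i.+1 <= ext x i])) => i.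
  have := hpoly_le 0 (linB (lin_ext i.+1) (lin_ext i)); congr hpoly.
  by apply/funext => x /=; rewrite subr_le0.
have h3 := hpoly_le 1 (linB (lin_ext 0) (lin_ext m)).
have := hpolyI h1 (hpolyI h2 h3); congr hpoly.
by apply/seteqP; split=> x /= => [[? []]|[]].
Qed.

Lemma nonincreasing_chain (f : nat -> R) m :
  (forall i, (i < m)%N -> f i.+1 <= f i) ->
  forall i j, (i <= j <= m)%N -> f j <= f i.
Proof.
move=> fm i j /andP[]; elim: j => [|j IH]; first by rewrite leqn0 => /eqP ->.
rewrite leq_eqVlt => /predU1P[->//|ij] jm.
by apply: le_trans (fm j jm) (IH _ _) => //; exact: ltnW.
Qed.

(** * The screw motion *)

Variable k : nat.
Hypothesis kn : (k < n)%N.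

(** [tau] puts the old coordinate [cyc i] in place [i], so [x_k] wraps around to the front and
    [x_0, ..., x_(k-1)] move one place back. *)
Definition cyc (i : nat) : nat :=
  if i == 0 then k else if (i <= k)%N then i.-1 else i.

(* Chosen so that [tau] raises [helm k.+1] by one and fixes every later [helm j]. *)
Definition shift_const : R := if (k.+1 < n)%N then k.+2%:R^-1 else 0.

Definition shift (j : nat) : R := (j == 0)%:R - (j <= k.+1)%:R * shift_const.

Definition tau x : 'rV[R]_n := \row_i (ext x (cyc i) + shift i).

(** The padding zeros stay 0: [shift j = 0] for [j >= n], in particular for [j = k.+1 = n], where
    [shift_const] is 0 by definition. *)
Lemma ext_tau x j : ext (tau x) j = ext x (cyc j) + shift j.
Proof.
have [jn|nj] := ltnP j n.
  by rewrite /ext insubT /= mxE.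
rewrite ext_ge //.
have j0 : (j == 0) = false by case: (j) nj kn => //; rewrite leqn0 => /eqP ->.
have jk : (j <= k)%N = false by apply/negbTE; rewrite -ltnNge (leq_trans kn).
rewrite /cyc /shift j0 jk ext_ge // add0r sub0r /shift_const.
case: ltnP => [kn'|]; last by rewrite mulr0 oppr0.
by rewrite leqNgt (leq_trans kn' nj) mul0r oppr0.
Qed.

Lemma cyc_lt i : (i < n)%N -> (cyc i < n)%N.
Proof.
move=> ni; rewrite /cyc; case: eqP => // _; case: ifP => // _.
exact: leq_ltn_trans (leq_pred _) ni.
Qed.

Lemma cyc_inj : injective cyc.
Proof.
rewrite /cyc => -[|i] [|j] //=; do ?[case: ifP => ? //=]; lia.
Qed.

Lemma affine_bij_tau : affine_bij tau.
Proof.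
pose h (i : 'I_n) : 'I_n := Ordinal (cyc_lt (ltn_ord i)).
have h_inj : injective h by move=> i j /(congr1 val)/cyc_inj/val_inj.
exists (perm_mx (perm h_inj)^-1), (\row_i shift i); split; first exact: unitmx_perm.
apply/funext => x; rewrite -col_permE; apply/rowP => i.
by rewrite !mxE permE -ext_ord.
Qed.

Lemma sum_cyc (f : nat -> R) j : (k < j)%N ->
  \sum_(i < j) f (cyc i) = \sum_(i < j) f i.
Proof.
elim: j => // j IH; rewrite ltnS leq_eqVlt => /predU1P[<-|kj].
  rewrite big_ord_recl [RHS]big_ord_recr addrC /=; congr (_ + _).
  by apply: eq_bigr => i _; rewrite /cyc /= /bump /= add1n ltn_ord.
rewrite !big_ord_recr /= IH //; congr (_ + f _).
by rewrite /cyc leqNgt kj; case: eqP => // j0; rewrite j0 in kj.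
Qed.

Lemma sum_shift_le j : (0 < j <= k.+2)%N ->
  \sum_(i < j) shift i = 1 - j%:R * shift_const.
Proof.
case: j => // j /= jk; rewrite sumrB; congr (_ - _).
  by rewrite big_ord_recl /= big1 ?addr0.
rewrite (eq_bigr (fun=> shift_const)); last first.
  by move=> i _; rewrite -ltnS (leq_trans (ltn_ord i) jk) mul1r.
by rewrite sumr_const card_ord mulr_natl.
Qed.

Lemma helm_shift j : (k < j < n.+1)%N ->
  \sum_(i < j) shift i - j%:R * shift j = (j == k.+1)%:R.
Proof.
move=> /andP[kj jn]; have j0 : (j == 0) = false by case: (j) kj.
case: (ltngtP j k.+1) => [|kj'|->]; first by lia.
(* Beyond [k.+1] the shift is 0, and over the first [k + 2] indices it sums to 0. *)
- have kn' : (k.+1 < n)%N by lia.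
  rewrite [shift j]/shift j0 leqNgt kj' mul0r subrr mulr0 subr0.
  elim: j kj' {kj jn j0} => // j IH; rewrite ltnS leq_eqVlt => /predU1P[<-|kj].
    by rewrite sum_shift_le ?leqnn // /shift_const kn' divff ?subrr.
  rewrite big_ord_recr /= IH // /shift leqNgt kj mul0r.
  by case: (j) kj => //= *; rewrite subrr addr0.
rewrite sum_shift_le; last by rewrite ltnS leqnSn.
by rewrite /shift leqnn /= sub0r mul1r mulrN opprK addrNK.
Qed.

Lemma helm_tau j x : (k < j < n.+1)%N -> helm j (tau x) = helm j x + (j == k.+1)%:R.
Proof.
move=> kjn; rewrite -helm_shift // /helm ext_tau.
under eq_bigr do rewrite ext_tau; rewrite big_split /= sum_cyc; last by case/andP: kjn.
have -> : cyc j = j.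
  case/andP: kjn => kj _; rewrite /cyc leqNgt kj.
  by case: eqP => // j0; rewrite j0 in kj.
ring.
Qed.

(** * The prism and its two fundamental domains *)

Definition prism : set 'rV[R]_n := [set x |
  [/\ forall j, (j < n.+1)%N -> (k.+1 < j)%N -> 0 <= helm j x <= 1,
      forall i, (i < k)%N -> ext x i.+1 <= ext x i
    & ext x 0 - ext x k <= 1]].

Lemma region_prism : region k = prism `&` [set x | 0 <= helm k.+1 x <= 1].
Proof.
apply/seteqP; split=> [x [xh xc x0]|x [[xh xc x0] xk]]; split=> //.
- by split=> // j jn kj; apply: xh => //; exact: ltnW.
- by apply: xh.
move=> j jn; rewrite leq_eqVlt => /predU1P[<-//|]; exact: xh.
Qed.

Lemma regionS_prism :
  region k.+1 = prism `&` [set x | ext x k.+1 <= ext x k /\ ext x 0 - ext x k.+1 <= 1].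
Proof.
apply/seteqP; split=> [x [xh xc x0]|x [[xh xc x0] [xk xk']]]; split=> //.
- split=> // [i ik|]; first by apply: xc; exact: ltnW.
  by have := xc k (ltnSn k); lra.
- by split=> //; exact: xc.
by move=> i; rewrite ltnS leq_eqVlt => /predU1P[->//|]; exact: xc.
Qed.

Lemma shiftS i : (i <= k)%N -> shift i.+1 = - shift_const.
Proof. by move=> ik; rewrite /shift ltnS ik mul1r sub0r. Qed.

Lemma shift0 : shift 0 = 1 - shift_const.
Proof. by rewrite /shift mul1r. Qed.

Lemma cycS i : (i < k)%N -> cyc i.+1 = i.
Proof. by move=> ik; rewrite /cyc /= ik. Qed.

Lemma cycS_top : cyc k.+1 = k.+1.
Proof. by rewrite /cyc /= ltnn. Qed.

(** The inequalities [x_0 >= ... >= x_k >= x_0 - 1] form a cycle, which [tau] rotates by one place;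
    the bounds on later [helm j] are unaffected. *)
Lemma prism_tau x : prism (tau x) <-> prism x.
Proof.
have E (i : nat) : (i < k)%N -> ext (tau x) i.+1 = ext x i - shift_const.
  by move=> ik; rewrite ext_tau cycS // shiftS // ltnW.
have E0 : ext (tau x) 0 = ext x k + 1 - shift_const.
  by rewrite ext_tau shift0 addrA.
have H j : (j < n.+1)%N -> (k.+1 < j)%N -> helm j (tau x) = helm j x.
  by move=> jn kj; rewrite helm_tau ?jn ?(ltnW kj) // gtn_eqF // addr0.
split=> -[xh xc x0].
  split=> [j jn kj|i ik|]; first by rewrite -H //; exact: xh.
    have [ik'|] := ltnP i.+1 k.
      by have := xc _ ik'; rewrite !E //; lra.
    case: k ik xc x0 E E0 => // k' ik xc x0 E E0 ki; have -> : i = k' by lia.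
    by move: x0; rewrite E0 E //; lra.
  case: (posnP k) => [->|k0]; first by rewrite subrr ler01.
  by have := xc _ k0; rewrite E // E0; lra.
split=> [j jn kj|i ik|]; first by rewrite H //; exact: xh.
  case: i ik => [|i] ik; first by rewrite E // E0; lra.
  by rewrite !E // ?(ltnW ik) //; have := xc i (ltnW ik); lra.
case: (k) E E0 xc x0 => [|k'] E E0 xc x0; first by rewrite subrr ler01.
by rewrite E0 E //; have := xc k' (ltnSn _); lra.
Qed.

Lemma iter_tau_prism i x : prism (iter i tau x) <-> prism x.
Proof. by elim: i => //= i IH; rewrite prism_tau. Qed.

Lemma helm_iter_tau i x : helm k.+1 (iter i tau x) = helm k.+1 x + i%:R.
Proof.
elim: i => [|i IH] /=; first by rewrite addr0.
by rewrite helm_tau ?ltnSn ?ltnS // eqxx IH -addrA natr1.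
Qed.

Lemma affine_bij_iter_tau i : affine_bij (iter i tau).
Proof.
elim: i => [|i IH]; first exact: affine_bij_id.
exact: (affine_bij_comp affine_bij_tau IH).
Qed.

Definition gap x : R := ext x k - ext x k.+1.

(* Pieces of [region k] overlap only where [gap] vanishes: [gap] is nonnegative on
   [region k.+1], nondecreasing along orbits, and nonpositive just before [tau]
   maps a point into [region k.+1]. *)
Lemma gap_tau x : prism x -> gap x <= gap (tau x).
Proof.
move=> [_ xc x0]; rewrite /gap !ext_tau cycS_top shiftS //.
have [k0|k0] := posnP k.
  have -> : cyc k = k by rewrite /cyc k0.
  have -> : shift k = 1 - shift_const by rewrite k0 shift0.
  lra.
rewrite /cyc /shift gtn_eqF // leqnn leqnSn mul1r sub0r.
by have := xc k.-1; rewrite prednK // => /(_ (leqnn k)); lra.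
Qed.

Lemma gap_iter_tau i x : prism x -> gap x <= gap (iter i tau x).
Proof.
move=> px; elim: i => //= i IH; apply: le_trans IH _; apply: gap_tau.
by apply/iter_tau_prism.
Qed.

Lemma top_tau x : ext (tau x) 0 - ext (tau x) k.+1 = gap x + 1.
Proof. by rewrite !ext_tau shift0 shiftS // cycS_top /gap /cyc /=; ring. Qed.

(** [helm k.+1 x] is the sum of [x_i - x_(k+1)] for [i <= k]; the last term is the gap and the
    others are at most [x_0 - x_(k+1)]. *)
Lemma helm_le x : prism x -> helm k.+1 x <= k%:R * (ext x 0 - ext x k.+1) + gap x.
Proof.
move=> [_ xc _]; rewrite /helm big_ord_recr /= /gap.
have : \sum_(i < k) ext x i <= k%:R * ext x 0.
  rewrite mulr_natl -[X in _ *+ X]card_ord -sumr_const; apply: ler_sum => i _.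
  by apply: (nonincreasing_chain xc); rewrite /= ltnW.
by rewrite -natr1; nra.
Qed.

Lemma helm_ge x : prism x -> k.+1%:R * gap x <= helm k.+1 x.
Proof.
move=> [_ xc _]; rewrite /helm /gap mulrBr lerB //.
rewrite mulr_natl -[X in _ *+ X]card_ord -sumr_const; apply: ler_sum => i _.
by apply: (nonincreasing_chain xc); rewrite -ltnS ltn_ord /=.
Qed.

Lemma prism_gap_ge0 x : prism x -> 0 <= gap x -> forall i, (i < k.+1)%N ->
  0 <= ext x i - ext x k.+1.
Proof.
move=> [_ xc _] gx i ik; apply: le_trans gx _; rewrite /gap lerB //.
by apply: (nonincreasing_chain xc); rewrite -ltnS ik /=.
Qed.

(** The exit time is the first [i] at which the gap is nonnegative. If the gap were negative for all
    [i <= k], [helm_le] and [top_tau] would bound [helm k.+1] of the [k]-th iterate below [k],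
    although it is at least [k]. *)
Lemma region_exit x : region k x -> exists2 i, (i < k.+1)%N & region k.+1 (iter i tau x).
Proof.
rewrite region_prism regionS_prism => -[px /= /andP[h0 h1]].
have pt i : prism (iter i tau x) by apply/iter_tau_prism.
have ex : exists i, (i < k.+1)%N && (0 <= gap (iter i tau x)).
  apply: contrapT => /forallNP ne; have {}ne i : (i < k.+1)%N -> gap (iter i tau x) < 0.
    by move=> ik; rewrite ltNge; apply/negP => gi; apply: (ne i); rewrite ik.
  have := helm_le (pt k); rewrite helm_iter_tau; have := ne k (ltnSn k).
  have [k0|k0] := posnP k.
    by have -> : k%:R = 0 :> R by [rewrite k0]; rewrite mul0r; lra.
  have -> : ext (iter k tau x) 0 - ext (iter k tau x) k.+1 = gap (iter k.-1 tau x) + 1.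
    by rewrite -top_tau -iterS prednK.
  have := ne k.-1; rewrite prednK // => /(_ (leqnSn k)).
  set a := gap _; set b := gap _; move=> a0 b0.
  have : k%:R * (a + 1) <= k%:R :> R.
    by rewrite -[leRHS]mulr1 ler_wpM2l //; lra.
  lra.
case: (ex_minnP ex) => i /andP[ik gi] imin; exists i => //; split; first exact: pt.
split; first by rewrite -subr_ge0.
(* For [i > 0] the previous gap is negative, so [top_tau] gives the last bound. For [i = 0] the
   difference is one of the nonnegative summands of [helm k.+1 x], which is at most 1. *)
case: i ik gi imin => [|i] ik gi imin; last first.
  rewrite /= top_tau; have := imin i; rewrite (ltn_trans (ltnSn i) ik) /= ltnn.
  by case: (lerP 0 (gap (iter i tau x))) => [_ /(_ isT)//|]; lra.
apply: le_trans h1; rewrite /= /helm mulr_natl.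
rewrite -[X in _ *+ X]card_ord -sumr_const -sumrB big_ord_recl /= lerDl.
by apply: sumr_ge0 => j _; apply: (prism_gap_ge0 px gi); exact: (ltn_ord (lift ord0 j)).
Qed.

Lemma helm_region x : region k.+1 x -> 0 <= helm k.+1 x <= k.+1%:R.
Proof.
rewrite regionS_prism => -[px [xk x0]]; apply/andP; split.
  by apply: le_trans (helm_ge px); rewrite mulr_ge0 // subr_ge0.
apply: le_trans (helm_le px) _; rewrite -natr1 lerD //.
  by rewrite -[leRHS]mulr1 ler_wpM2l.
apply: le_trans x0; rewrite /gap lerB //; case: px => _ xc _.
by apply: (nonincreasing_chain xc); rewrite leqnn.
Qed.

Lemma nat_floor (h : R) m : 0 <= h <= m.+1%:R ->
  exists2 i, (i < m.+1)%N & i%:R <= h <= i.+1%:R.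
Proof.
elim: m => [|m IH] /andP[h0 hm]; first by exists 0%N => //; rewrite h0.
have [/ltW hm'|hm'] := ltP h m.+1%:R; last by exists m.+1; rewrite // hm' hm.
by have [|i im hi] := IH; [rewrite h0|exists i => //; exact: leqW].
Qed.

Lemma ext_delta (i : 'I_n) j : ext (delta_mx 0 i) j = (j == i)%:R.
Proof.
have [jn|nj] := ltnP j n.
  by rewrite -[j]/(val (Ordinal jn)) ext_ord mxE eqxx.
by rewrite ext_ge // gtn_eqF // (leq_trans _ nj).
Qed.

Lemma step_equidissectable (iso : ('rV[R]_n -> 'rV[R]_n) -> Prop) :
  (forall i, iso (iter i tau)) -> equidissectable iso k.+1 (region k) (region k.+1).
Proof.
move=> iso_tau.
pose Q (i : 'I_k.+1) := region k `&` iter i tau @^-1` region k.+1.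
exists 'I_k.+1, Q, (fun i => iter (val i) tau); split.
- by rewrite card_ord.
- move=> i; apply: hpolyI; first exact: hpoly_region.
  by apply: hpoly_preimage; [exact: affine_bij_iter_tau|exact: hpoly_region].
- by move=> i; split=> //; exact: affine_bij_iter_tau.
- split.
    apply/seteqP; split=> [x rx|x [i _ []]] //.
    by have [i ik ri] := region_exit rx; exists (Ordinal ik).
  (* On an overlap the gap is nonnegative at time [i] and nonpositive at time [j - 1]; being
     nondecreasing, it is 0 at time [i], so the overlap lies in a hyperplane. *)
  have gap0 (i j : 'I_k.+1) x : (i < j)%N -> Q i x -> Q j x -> gap (iter i tau x) = 0.
    move=> ij [rx ri] [_ rj]; move: (rx) (ri) (rj); rewrite /preimage /=.
    rewrite regionS_prism region_prism => -[px _] [_ [gi _]] [_ [_]].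
    have -> : iter j tau x = tau (iter (j - i).-1 tau (iter i tau x)).
      by rewrite -iterS -iterD; congr iter; lia.
    rewrite top_tau => tj.
    have pi : prism (iter i tau x) by apply/iter_tau_prism.
    have := gap_iter_tau (j - i).-1 pi; move: gi; rewrite -subr_ge0 -/(gap _).
    by move=> *; apply/eqP; rewrite eq_le; apply/andP; split; lra.
  have disj (i j : 'I_k.+1) x : (i < j)%N -> (Q i)° x -> ~ (Q j)° x.
    move=> ij xi xj; have : (Q i `&` Q j)° x by rewrite interiorI.
    have : Q i `&` Q j `<=` iter i tau @^-1` [set z | gap z = 0].
      by move=> z [zi zj]; exact: gap0 ij zi zj.
    move=> /interiorS/[apply]/(interior_preimage (affine_bij_iter_tau i)).
    rewrite (@level_interior _ _ gap 0 (delta_mx 0 (Ordinal kn))) //.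
      exact: linB (lin_ext _) (lin_ext _).
    by rewrite /gap !ext_delta eqxx gtn_eqF // subr0 oner_eq0.
  move=> i j _ _ [x [/= xi xj]]; apply/val_inj => /=.
  by case: (ltngtP i j) => // ij; [have := disj _ _ _ ij xi|have := disj _ _ _ ij xj].
(* The images are the slabs of unit height in [helm k.+1], which fill [region k.+1] and meet only in
   level sets. *)
have QE (i : 'I_k.+1) : iter i tau @` Q i =
    region k.+1 `&` [set x | i%:R <= helm k.+1 x <= i.+1%:R].
  apply/seteqP; split=> [_ [x [rx ri] <-]|y [ry /= hy]].
    split=> //=; move: rx; rewrite region_prism helm_iter_tau => -[_ /=].
    by rewrite -[i.+1%:R]natr1; lra.
  have [h [_ _ hK]] := affine_bij_inv (affine_bij_iter_tau i).
  exists (h y) => //; split; last by rewrite /preimage /= hK.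
  rewrite region_prism; split.
    by apply/(iter_tau_prism i); rewrite hK; move: ry; rewrite regionS_prism => -[].
  have := helm_iter_tau i (h y); rewrite hK /= => hE.
  by move: hy; rewrite hE -[i.+1%:R]natr1; lra.
split.
  apply/seteqP; split=> [x rx|x [i _]]; last by rewrite QE => -[].
  have [i ik hi] := nat_floor (helm_region rx).
  by exists (Ordinal ik) => //; rewrite QE.
have disj (i j : 'I_k.+1) x : (i < j)%N -> (iter i tau @` Q i)° x ->
    ~ (iter j tau @` Q j)° x.
  move=> ij xi xj; have : (iter i tau @` Q i `&` iter j tau @` Q j)° x by rewrite interiorI.
  have : iter i tau @` Q i `&` iter j tau @` Q j `<=` [set z | helm k.+1 z = i.+1%:R].
    move=> z; rewrite !QE => -[[_ /= /andP[_ hi]] [_ /= /andP[hj _]]].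
    apply/eqP; rewrite eq_le hi (le_trans _ hj) // ler_nat //.
  move=> /interiorS/[apply].
  rewrite (@level_interior _ _ (helm k.+1) _
    (delta_mx 0 (Ordinal (leq_ltn_trans (leq0n k) kn)))) //.
    exact: lin_helm.
  rewrite /helm big_ord_recl /= !ext_delta eqxx big1 => [|l _]; last by rewrite ext_delta.
  by rewrite mulr0 subr0 addr0 oner_eq0.
move=> i j _ _ [x [/= xi xj]]; apply/val_inj => /=.
by case: (ltngtP i j) => // ij; [have := disj _ _ _ ij xi|have := disj _ _ _ ij xj].
Qed.

End Coordinates.

(** * Affine images of polytopes, boundedness of the simplex, and the Gram form *)

Section Bricks.
Variables (R : realType) (n : nat).
Implicit Types (x y : 'rV[R]_n) (A B : set 'rV[R]_n).

(** Kept for arbitrary coefficient sums: sum 0 gives affine independence of the image, sum 1 gives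
    its hull. *)
Lemma affine_bij_sum (g : 'rV[R]_n -> 'rV[R]_n) : affine_bij g ->
  exists2 M : 'M[R]_n, M \in unitmx & exists t, forall m (c : 'I_m -> R) p,
    \sum_i c i *: g (p i) = (\sum_i c i *: p i) *m M + (\sum_i c i) *: t.
Proof.
move=> [M [t [uM ->]]]; exists M => //; exists t => m c p.
rewrite mulmx_suml scaler_suml -big_split /=; apply: eq_bigr => i _.
by rewrite scalerDr scalemxAl.
Qed.

Lemma nsimplex_image (g : 'rV[R]_n -> 'rV[R]_n) A :
  affine_bij g -> nsimplex A -> nsimplex (g @` A).
Proof.
move=> ag [p [ip ->]]; have [M uM [t gE]] := affine_bij_sum ag.
exists (g \o p); split.
  move=> c c0; rewrite gE c0 scale0r addr0 => cM; apply: ip => //.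
  by rewrite -[LHS](mulmxK uM) cM mul0mx.
have E (c : 'I_n.+1 -> R) : \sum_i c i = 1 ->
    \sum_i c i *: g (p i) = g (\sum_i c i *: p i).
  move=> c1; rewrite gE c1 scale1r; have := gE 1%N (fun=> 1) (fun=> \sum_i c i *: p i).
  by rewrite !big_ord1 !scale1r.
apply/seteqP; split=> [_ [_ [c [c0 c1 ->]] <-]|_ [c [c0 c1 ->]]].
  by exists c; split=> //; rewrite -E.
by exists (\sum_i c i *: p i); [exists c|rewrite -E].
Qed.

Lemma polytope_image (g : 'rV[R]_n -> 'rV[R]_n) A :
  affine_bij g -> polytope A -> polytope (g @` A).
Proof.
move=> ag [m [S [sS ->]]]; exists m, (fun j => g @` S j); split.
  by move=> j; exact: nsimplex_image.
by rewrite image_bigcup.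
Qed.

Lemma in_region_top x : region n x <->
  (forall i, (i < n)%N -> ext x i.+1 <= ext x i) /\ ext x 0 <= 1.
Proof.
split=> [[_ xc x0]|[xc x0]].
  by rewrite [ext x n]ext_ge // subr0 in x0.
by split=> //; [move=> j jn; rewrite ltnNge -ltnS jn|rewrite [ext x n]ext_ge // subr0].
Qed.

Lemma region_top_bounds x i : region n x -> (i < n)%N -> 0 <= ext x i <= 1.
Proof.
move=> /in_region_top[xc x0] ni; apply/andP; split.
  rewrite -(ext_ge x (leqnn n)); apply: (nonincreasing_chain xc).
  by rewrite leqnn ltnW.
by apply: le_trans x0; apply: (nonincreasing_chain xc); rewrite leq0n ltnW.
Qed.

(** [region n] lies in the larger simplex with vertices 0 and [n] times the unit vectors, whose
    generators are explicit; [A] is cut out of it by half-spaces. *)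
Lemma fingen_region_sub A : (0 < n)%N -> hpoly A -> A `<=` region n -> fingen A.
Proof.
move=> n0 hA An; have n0' : n%:R != 0 :> R by rewrite pnatr_eq0 -lt0n.
pose B : set 'rV[R]_n := [set x | (forall i : 'I_n, 0 <= x 0 i)] `&`
  [set x | \sum_(i < n) x 0 i <= n%:R].
have hB : hpoly B.
  apply: hpolyI; last by apply: hpoly_le; apply: lin_sum => i; exact: lin_coord.
  apply: (hpoly_forall (F := fun i => [set x : 'rV[R]_n | 0 <= x 0 i])) => i.
  by apply: hpoly_ge; exact: lin_coord.
apply: (@hpoly_fingen _ _ _ B) => //; last first.
  move=> x /An rx; split=> [i|] /=.
    by have := region_top_bounds rx (ltn_ord i); rewrite ext_ord => /andP[].
  rewrite -[X in X%:R]card_ord -sumr_const; apply: ler_sum => i _.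
  by have := region_top_bounds rx (ltn_ord i); rewrite ext_ord => /andP[].
pose q (k : 'I_n.+1) : 'rV[R]_n :=
  if unlift ord0 k is Some i then n%:R *: delta_mx 0 i else 0.
apply: (@fingen_fintype _ _ _ q) => [k|x [x0 xn]].
  rewrite /q; case: unliftP => [i _|_]; split=> /=.
  - by move=> j; rewrite !mxE mulr_ge0.
  - rewrite (bigD1 i) //= !mxE !eqxx mulr1 big1 ?addr0 // => j ji.
    by rewrite !mxE (negPf ji) andbF mulr0.
  - by move=> j; rewrite mxE.
  - by rewrite big1 // => j _; rewrite mxE.
exists (fun k => if unlift ord0 k is Some i then x 0 i / n%:R
                 else 1 - (\sum_i x 0 i) / n%:R); split.
- move=> k; case: unliftP => [i _|_]; first by rewrite divr_ge0.
  by rewrite subr_ge0 ler_pdivrMr ?mul1r // ltr0n.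
- rewrite big_ord_recl unlift_none.
  rewrite [X in _ + X](eq_bigr (fun i => x 0 i / n%:R)); last by move=> i _; rewrite liftK.
  by rewrite -mulr_suml subrK.
rewrite big_ord_recl /q unlift_none scaler0 add0r [LHS]row_sum_delta.
by apply: eq_bigr => i _; rewrite liftK scalerA divfK.
Qed.

Lemma region_top_interior : (@region R n n)° !=set0.
Proof.
(* Equally spaced values strictly between 1 and 0 make every inequality of the chain strict. *)
pose x : 'rV[R]_n := \row_i ((n - i)%:R / n.+1%:R).
have xE j : ext x j = (n - j)%:R / n.+1%:R.
  have [jn|nj] := ltnP j n; last by rewrite ext_ge // (eqP nj) mul0r.
  by rewrite -[j]/(val (Ordinal jn)) ext_ord mxE.
have near_lt (f : 'rV[R]_n -> R) b : lin f -> f x < b -> \forall y \near x, f y < b.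
  move=> lf fb; have c : continuous f by exact: lin_continuous.
  by apply: (cvgr_lt (f x) (c x)).

have n1 : 0 < n.+1%:R^-1 :> R by rewrite invr_gt0 ltr0n.
have H1 : \forall y \near x, forall i : 'I_n, ext y i.+1 - ext y i < 0.
  suff H (i : 'I_n) : \forall y \near x, ext y i.+1 - ext y i < 0.
    exact: (@filter_forall _ 'I_n (fun i y => ext y i.+1 - ext y i < 0) _ _ H).
  apply: (near_lt (fun y => ext y i.+1 - ext y i)).
    by apply: linB; exact: lin_ext.
  by rewrite !xE subr_lt0 ltr_pM2r // ltr_nat; have := ltn_ord i; lia.
have H2 : \forall y \near x, ext y 0 < 1.
  apply: (near_lt (fun y => ext y 0)); first exact: lin_ext.
  by rewrite xE subn0 ltr_pdivrMr ?ltr0n // mul1r ltr_nat.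
exists x; apply: filterS2 H1 H2 => y y1 y2; apply/in_region_top; split; last exact: ltW.
by move=> i ni; have := y1 (Ordinal ni); rewrite subr_lt0 => /ltW.
Qed.

Variable w : R.

(** The squared length of the vector with coordinates [x] in the basis [v]. It is symmetric in the
    coordinates, which is why [tau], a permutation followed by a translation, preserves it. *)
Definition gram_form x : R :=
  (1 + w) * \sum_(i < n) ext x i ^+ 2 - w * (\sum_(i < n) ext x i) ^+ 2.

Definition gram_iso (g : 'rV[R]_n -> 'rV[R]_n) : Prop :=
  forall x y, gram_form (g x - g y) = gram_form (x - y).

Lemma ext_sub x y j : ext (x - y) j = ext x j - ext y j.
Proof.
by rewrite (lin_add _ _ (lin_ext R n j)) -scaleN1r (lin_scale _ _ (lin_ext R n j)) mulN1r.
Qed.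

Lemma gram_iso_tau k : (k < n)%N -> gram_iso (@tau R n k).
Proof.
move=> kn x y; rewrite /gram_form.
have E i : ext (tau k x - tau k y) i = ext (x - y) (cyc k i).
  by rewrite !ext_sub !ext_tau // opprD addrACA subrr addr0.
congr (_ * _ - _ * _ ^+ 2).
  under eq_bigr do rewrite E.
  exact: (sum_cyc (fun i => ext (x - y) i ^+ 2) kn).
under eq_bigr do rewrite E.
exact: (sum_cyc (fun i => ext (x - y) i) kn).
Qed.

Lemma gram_iso_iter g i : gram_iso g -> gram_iso (iter i g).
Proof. by move=> ig x y; elim: i => //= i IH; rewrite ig. Qed.

Lemma equidissectable_region m : (m <= n)%N ->
  equidissectable gram_iso m`! (@region R n 0) (@region R n m).
Proof.
elim: m => [_|m IH mn].
  by apply: equidissectable_refl; [|exact: hpoly_region].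
rewrite factS mulnC; apply: equidissectable_trans (IH (ltnW mn)) _.
  by move=> g h ig ih x y /=; rewrite ig ih.
by apply: (step_equidissectable mn) => i; apply: gram_iso_iter; exact: gram_iso_tau.
Qed.

(** Coefficient of [helm j.+1 x ^+ 2], hence the index shift. The last one belongs to [helm n], the
    sum of all coordinates; its positivity is the condition [w < 1 / (n - 1)] when [n >= 2]. *)
Definition brick_coef (j : nat) : R :=
  if (j.+1 < n)%N then (1 + w) / (j.+1%:R * j.+2%:R) else (1 + w) / n%:R - w.

Lemma helmert_sum x m : \sum_(i < m.+1) ext x i ^+ 2 =
  \sum_(j < m) helm j.+1 x ^+ 2 / (j.+1%:R * j.+2%:R)
  + (\sum_(i < m.+1) ext x i) ^+ 2 / m.+1%:R.
Proof.
elim: m => [|m IH]; first by rewrite !big_ord1 big_ord0 add0r divr1.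
rewrite big_ord_recr /= IH [X in _ = X + _]big_ord_recr /= -!addrA; congr (_ + _).
rewrite [in RHS]big_ord_recr /= /helm; set S := \sum_(i < m.+1) _.
have m1 : m.+1%:R != 0 :> R by rewrite pnatr_eq0.
have m2 : m.+2%:R != 0 :> R by rewrite pnatr_eq0.
have E : m.+2%:R = m.+1%:R + 1 :> R by rewrite natr1.
move: m1 m2; rewrite E; move: (m.+1%:R : R) => a a0 a1.
by field; apply/andP; split.
Qed.

Lemma gram_form_helm x : (0 < n)%N ->
  gram_form x = \sum_(j < n) brick_coef j * helm j.+1 x ^+ 2.
Proof.
move=> n0; have hn : helm n x = \sum_(i < n) ext x i.
  by rewrite /helm [ext x n]ext_ge // mulr0 subr0.
transitivity (\sum_(j < n.-1.+1) brick_coef j * helm j.+1 x ^+ 2); last by rewrite prednK.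
rewrite big_ord_recr /= prednK // hn.
have := helmert_sum x n.-1; rewrite prednK // /gram_form => ->.
rewrite /brick_coef prednK // ltnn mulrDr mulr_sumr -addrA; congr (_ + _); last by ring.
apply: eq_bigr => j _; rewrite ifT; first by ring.
by have := ltn_ord j; lia.
Qed.

Lemma brick_coef_gt0 : -1 < w -> ((2 <= n)%N -> w < 1 / (n.-1)%:R) ->
  (0 < n)%N -> forall j, 0 < brick_coef j.
Proof.
move=> w1 wn n0 j; rewrite /brick_coef; case: ifP => _.
  by rewrite divr_gt0 ?mulr_gt0 ?ltr0n //; lra.
rewrite subr_gt0 ltr_pdivlMr ?ltr0n //.
case: (ltngtP 1 n) wn n0 => [n1 /(_ isT)|n1|<-] //; last by move=> *; lra.
  rewrite ltr_pdivlMr ?ltr0n; last by lia.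
  by move=> wn _; have -> : n%:R = (n.-1)%:R + 1 :> R by [rewrite natr1 prednK //; lia]; lra.

Qed.

(** Vanishing forms make each coordinate the mean of the preceding ones, so all are equal, including
    the padding value 0 at index [n]. *)
Lemma helm_eq0 x : (0 < n)%N -> (forall j : 'I_n, helm j.+1 x = 0) -> x = 0.
Proof.
move=> n0 hx.
have H j : (j < n)%N -> \sum_(i < j.+1) ext x i = j.+1%:R * ext x 0 /\ ext x j.+1 = ext x 0.
  elim: j => [|j IH] jn.
    have := hx (Ordinal jn); rewrite /helm /= !big_ord1 mul1r => /eqP.
    by rewrite subr_eq0 => /eqP <-; rewrite mul1r.
  have [Sj xj] := IH (ltnW jn).
  have S : \sum_(i < j.+2) ext x i = j.+2%:R * ext x 0.
    by rewrite big_ord_recr /= Sj xj -[j.+2%:R]natr1 mulrDl mul1r.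
  split=> //; have := hx (Ordinal jn); rewrite /helm /= S -mulrBr => /eqP.
  by rewrite mulf_eq0 pnatr_eq0 /= subr_eq0 => /eqP.
have x0 : ext x 0 = 0.
  by have [_ <-] := H n.-1 (eq_leq (prednK n0)); rewrite prednK // ext_ge.
apply/rowP => i; rewrite mxE -ext_ord.
by case: i => -[|i] ni /=; [|have [_ ->] := H i (ltnW ni)].
Qed.

End Bricks.

(** * Euclidean realization of the simplex and the brick *)

Section Euclidean.
Variables (R : realType) (n : nat).
Implicit Types (x y : 'rV[R]_n).

Lemma dot_eq0 x : dot x x = 0 -> x = 0.
Proof.
move=> d0; apply/rowP => i; rewrite mxE; apply/eqP; rewrite -sqrf_eq0 expr2.
by apply/eqP; apply: (psumr_eq0P _ d0) => // j _; rewrite -expr2 sqr_ge0.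
Qed.

Lemma dot_row_comb (v : 'I_n -> 'rV[R]_n) x :
  dot (x *m \matrix_i v i) (x *m \matrix_i v i) =
  \sum_i \sum_j x 0 i * x 0 j * dot (v i) (v j).
Proof.
rewrite /dot; under eq_bigr do rewrite !mxE mulr_suml.
rewrite exchange_big /=; apply: eq_bigr => i _.
under eq_bigr do rewrite mulr_sumr.
rewrite exchange_big /=; apply: eq_bigr => j _.
by rewrite mulr_sumr; apply: eq_bigr => k _; rewrite !mxE; ring.
Qed.

Lemma unitmx_of_ker (M : 'M[R]_n) : (forall x, x *m M = 0 -> x = 0) -> M \in unitmx.
Proof. by move=> kM; rewrite -row_free_unit; exact: inj_row_free. Qed.

Lemma gram_form_dot w (v : 'I_n -> 'rV[R]_n) x :
  (forall i, dot (v i) (v i) = 1) ->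
  (forall i j, i != j -> dot (v i) (v j) = - w) ->
  dot (x *m \matrix_i v i) (x *m \matrix_i v i) = gram_form w x.
Proof.
move=> v1 vw; rewrite dot_row_comb /gram_form.
have E : \sum_(i < n) ext x i = \sum_i x 0 i by apply: eq_bigr => i _; rewrite ext_ord.
rewrite E mulr_sumr expr2 mulr_suml mulr_sumr -sumrB; apply: eq_bigr => i _.
rewrite ext_ord mulr_sumr mulr_sumr (bigD1 i) //= v1 [in RHS](bigD1 i) //= opprD addrA.
congr (_ + _); first by ring.
rewrite -sumrN; apply: eq_bigr => j ji; rewrite vw 1?eq_sym //; ring.
Qed.

Lemma Qsimplex_region (v : 'I_n -> 'rV[R]_n) :
  Qsimplex v = (mulmx^~ (\matrix_i v i)) @` region n.
Proof.
have E (x : 'rV[R]_n) : x *m (\matrix_i v i) = \sum_i x 0 i *: v i.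
  by rewrite mulmx_sum_row; apply: eq_bigr => i _; rewrite rowK.
apply/seteqP; split=> [_ [lam [l01 lmono ->]]|_ [x rx <-]]; last first.
  exists (fun i => x 0 i); split=> [i|i j ij|//].
    by rewrite -ext_ord; exact: region_top_bounds.
  rewrite -!ext_ord; have [xc _] := (in_region_top x).1 rx.
  by apply: (nonincreasing_chain xc); rewrite ij /= ltnW.
exists (\row_i lam i); last by rewrite E; apply: eq_bigr => i _; rewrite mxE.
have xE (i : 'I_n) : ext (\row_i lam i) i = lam i by rewrite ext_ord mxE.
apply/in_region_top; split=> [i ni|].
  rewrite (xE (Ordinal ni)); have [ni'|ni'] := ltnP i.+1 n.
    by rewrite (xE (Ordinal ni')); apply: lmono => /=.
  by rewrite ext_ge //; have /andP[] := l01 (Ordinal ni).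
have [n0|n0] := ltnP 0 n; last by rewrite ext_ge // ler01.
by rewrite (xE (Ordinal n0)); have /andP[] := l01 (Ordinal n0).
Qed.

Lemma box_region (F : 'M[R]_n) (l : 'I_n -> R) : F \in unitmx ->
  (forall j, 0 < l j) -> (forall x j, (x *m F) 0 j = l j * helm j.+1 x) ->
  box l = (mulmx^~ F) @` region 0.
Proof.
move=> uF l0 FE; apply/seteqP; split=> [y yl|_ [x [xh _ _] <-] j]; last first.
  rewrite FE; have /andP[h0 h1] := xh j.+1 (ltn_ord j) isT.
  by rewrite mulr_ge0 ?(ltW (l0 j)) //= -[leRHS]mulr1 ler_wpM2l // ltW.
exists (y *m invmx F); last by rewrite mulmxKV.
split=> //; last by rewrite subrr ler01.
move=> [//|j] jn _; pose k := Ordinal (jn : (j < n)%N).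
have yE : y 0 k = l k * helm j.+1 (y *m invmx F) by rewrite -FE mulmxKV.
have := yl k; rewrite yE => /andP[h0 h1].
by rewrite pmulr_rge0 // in h0; rewrite ger_pMr // in h1; rewrite h0 h1.
Qed.

End Euclidean.

(** * Assembly of the dissection *)

Lemma bigcup_enum_val (T : Type) (I : finType) (K : pred I) (F : I -> set T) :
  \bigcup_(i in [set i | K i]) F i = \bigcup_a F (@enum_val _ K a).
Proof.
apply/seteqP; split=> x [i Ki Fx]; last by exists (enum_val i) => //; exact: enum_valP.
by exists (enum_rank_in (Ki : i \in K) i) => //; rewrite enum_rankK_in.
Qed.

Theorem mainTheorem3 (R : realType) (n : nat) (w : R) (v : 'I_n -> 'rV[R]_n)
  (hn : (1 <= n)%N) (hw : -1 < w) (hw' : (2 <= n)%N -> w < 1 / (n.-1)%:R)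
  (hv1 : forall i, dot (v i) (v i) = 1)
  (hv : forall i j, i != j -> dot (v i) (v j) = - w) :
  exists (k : nat) (l : 'I_n -> R)
    (P Q : 'I_k -> set 'rV[R]_n) (g : 'I_k -> 'rV[R]_n -> 'rV[R]_n),
    (1 <= k <= n`!)%N /\
    (forall i, 0 < l i) /\
    (forall i, polytope (P i)) /\
    (forall i, polytope (Q i)) /\
    dissection (Qsimplex v) P /\
    dissection (box l) Q /\
    (forall i, eisometry (g i)) /\
    (forall i, g i @` P i = Q i).
Proof.
have c0 : forall j : nat, 0 < brick_coef n w j by exact: brick_coef_gt0.
pose V := \matrix_i v i.
have dotV x : dot (x *m V) (x *m V) = gram_form w x by exact: gram_form_dot.
have [u uE] := choice (fun j : 'I_n => lin_helm R n j.+1).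
(* The edges are the square roots of the diagonal coefficients, so [F] and [V] both turn the Gram
   form into the squared Euclidean length. *)
pose l (j : 'I_n) := Num.sqrt (brick_coef n w j).
have l0 j : 0 < l j by rewrite sqrtr_gt0.
pose F := \matrix_(i, j) (l j * u j i 0).
have FE x j : (x *m F) 0 j = l j * helm j.+1 x.
  by rewrite uE !mxE mulr_sumr; apply: eq_bigr => i _; rewrite !mxE; ring.
have dotF x : dot (x *m F) (x *m F) = gram_form w x.
  rewrite gram_form_helm //; apply: eq_bigr => j _.
  by rewrite FE -expr2 exprMn sqr_sqrtr // ltW.
have uF : F \in unitmx.
  apply: unitmx_of_ker => x xF; apply: helm_eq0 => // j.
  have := FE x j; rewrite xF mxE => /esym/eqP.
  by rewrite mulf_eq0 gt_eqF //= => /eqP.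
have uV : V \in unitmx.
  apply: unitmx_of_ker => x xV; have := dotF x; rewrite -dotV xV.
  have -> : dot (0 : 'rV[R]_n) 0 = 0 by rewrite /dot big1 // => i _; rewrite mxE mulr0.
  by move=> /dot_eq0 xF; rewrite -[x](mulmxK uF) xF mul0mx.
have [aV aF] := (mulmx_affine_bij uV, mulmx_affine_bij uF).
have [I [S [g [cI hS ag [E0 tS] [En tT]]]]] := equidissectable_region w (leqnn n).
have [h hP] := choice (fun i => affine_bij_inv (ag i).1).
pose T i := g i @` S i.
have hT i : hpoly (T i) by apply: hpoly_image => //; case: (ag i).
have TS i : (T i)° !=set0 <-> (S i)° !=set0.
  rewrite /T image_interior; last by case: (ag i).
  by split=> [[_ [x Sx _]]|[x Sx]]; [exists x|exists (g i x); exists x].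
(* The closed pieces [T i] cover the nonempty interior of [region n], so one has interior, and so
   does the matching [S i]; hence [k >= 1]. *)
have [i1 Si1] : exists i, (S i)° !=set0.
  have [||||i [x [Tx _]]] := @closed_cover_interior _ _ (enum I) T (@region R n n)°.
  - by move=> i; exact: hpoly_closed.
  - exact: open_interior.
  - exact: region_top_interior.
  - move=> x /interior_subset; rewrite En => -[i _ Tx].
    by exists i; rewrite ?mem_enum.
  by exists i; apply/TS; exists x.
have int0 : (@region R n 0)° !=set0.
  case: Si1 => x Sx; exists x; move: Sx; apply: interiorS => y Sy.
  by rewrite E0; exists i1.
pose K : pred I := fun i => `[< (S i)° !=set0 >].
pose idx : 'I_#|K| -> I := @enum_val _ K.
have Kint a : (S (idx a))° !=set0 by apply/asboolP; exact: (enum_valP a).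
have cover0 : region 0 = \bigcup_a S (idx a).
  rewrite -(bigcup_enum_val K S).
  rewrite {1}(cover_drop (hpoly_convex (hpoly_region R n 0)) int0 _ E0).
    by congr bigcup; apply/seteqP; split=> i /asboolP.
  by move=> i; exact: hpoly_closed.
have covern : region n = \bigcup_a T (idx a).
  rewrite -(bigcup_enum_val K T).
  rewrite {1}(cover_drop (hpoly_convex (hpoly_region R n n)) (region_top_interior R n) _ En).
    congr bigcup; apply/seteqP; split=> i /=; first by move/TS/asboolP.
    by move=> /asboolP/TS.
  by move=> i; exact: hpoly_closed (hT i).
have polyT a : polytope (T (idx a)).
  apply: fingen_polytope => //; last by apply/TS.
  apply: fingen_region_sub => // x Tx; rewrite En; exists (idx a) => //.
have idx_inj : injective idx by exact: enum_val_inj.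
have dis (M : 'M[R]_n) (W : I -> set 'rV[R]_n) : M \in unitmx ->
    trivIset setT (fun i => (W i)°) ->
    trivIset setT (fun a => (mulmx^~ M @` W (idx a))°).
  move=> uM tW a b _ _ [x]; rewrite !image_interior; try exact: mulmx_affine_bij.
  move=> [[y Wy <-] [z Wz]] /(can_inj (mulmxK uM)) zy.
  by apply: idx_inj; apply: tW => //; exists y; split=> //; rewrite -zy.
exists #|K|, l, (fun a => mulmx^~ V @` T (idx a)), (fun a => mulmx^~ F @` S (idx a)).
(* Each motion passes from the simplex to coordinates, undoes [g], and passes to the brick; all
   three maps respect the Gram form. *)
exists (fun a x => h (idx a) (x *m invmx V) *m F); do !split.
- apply/andP; split; last exact: leq_trans (max_card _) cI.
  by apply/card_gt0P; exists i1; apply/asboolP.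
- exact: l0.
- by move=> a; apply: polytope_image aV (polyT a).
- move=> a; apply: polytope_image => //.
  have [ah gK hK] := hP (idx a).
  have -> : S (idx a) = h (idx a) @` T (idx a).
    rewrite /T image_comp (_ : _ \o _ = id) ?image_id //.
    by apply/funext => x /=; rewrite gK.
  exact: polytope_image.
- by rewrite Qsimplex_region covern image_bigcup.
- exact: dis.
- by rewrite (box_region uF l0 FE) cover0 image_bigcup.
- exact: dis.
- move=> a x y; rewrite /edist -mulmxBl dotF.
  have [ah gK hK] := hP (idx a); have [_ ig] := ag (idx a).
  rewrite -ig !hK -mulmxBl -dotV mulmxKV //.
move=> a; have [ah gK hK] := hP (idx a).
rewrite /T !image_comp; congr image; apply/funext => x /=.
by rewrite mulmxK // gK.
Qed.
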